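(* Let $\partial_{SP}\Omega$ be the set of all singleton ends of $\Omega$. Then there is a homeomorphism $\Phi:\Omega\cup\partial_{SP}\Omega\to\overline{\Omega}^M$ such that $\Phi|_\Omega$ is the identity map and $\Phi|_{\partial_{SP}\Omega}:\partial_{SP}\Omega\to\partial_M\Omega$.
   Context: Setting: $(X,d,\mu)$ is a metric measure space with more than one point, $\mu$ is a Borel measure with $0<\mu(B)<\infty$ for all balls $B$, and $1\le p<\infty$ is fixed. $X$ is complete, $\mu$ is doubling (there is $C_\mu>0$ with $\mu(B(x,2r))\le C_\mu\mu(B(x,r))$ for all balls), and $X$ supports a $p$-Poincaré inequality: there are $C_{PI}>0$, $\lambda\ge1$ such that for all balls $B$ and all $u\in N^{1,p}(X)$, $\frac{1}{\mu(B)}\int_B|u-u_B|\,d\mu\le C_{PI}\operatorname{diam}(B)\bigl(\frac{1}{\mu(\lambda B)}\int_{\lambda B}g_u^p\,d\mu\bigr)^{1/p}$, where $u_B=\frac{1}{\mu(B)}\int_B u\,d\mu$. Here a nonnegative Borel function $g$ is an upper gradient of $u:X\to[-\infty,\infty]$ if for every nonconstant rectifiable curve $\gamma:[0,l_\gamma]\to X$ parameterized by arc length, $|u(\gamma(0))-u(\gamma(l_\gamma))|\le\int_\gamma g\,ds$ when both values are finite, and $\int_\gamma g\,ds=\infty$ otherwise; $N^{1,p}(X)$ is the space of measurable $u$ with $\int_X|u|^p\,d\mu+\inf_g\int_X g^p\,d\mu<\infty$ (infimum over upper gradients $g$ of $u$), and $g_u$ is the minimal $p$-weak upper gradient of $u$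 (the a.e.-smallest $L^p$ function satisfying the upper gradient inequality for all curves except a family $\Gamma$ for which some nonnegative Borel $\rho\in L^p(X)$ has $\int_\gamma\rho\,ds=\infty$ for all $\gamma\in\Gamma$). $\Omega\subsetneq X$ is a bounded domain (bounded nonempty connected open set); closures and boundaries of subsets of $\Omega$ are taken in $X$. Ends: A bounded connected set $E\subsetneq\Omega$ is acceptable if $\overline E\cap\partial\Omega\ne\varnothing$. A sequence $\{E_k\}_{k=1}^\infty$ of acceptable sets is a chain if (i) $E_{k+1}\subset E_k$ for all $k$; (ii) $\operatorname{dist}(\Omega\cap\partial E_{k+1},\Omega\cap\partial E_k)>0$ for all $k$; (iii) the impression $\bigcap_{k=1}^\infty\overline{E}_k$ is contained in $\partial\Omega$. A chain $\{E_k\}$ divides a chain $\{F_k\}$ if for each $k$ there is $l$ with $E_l\subset F_k$. Two chains are equivalent if they divide each other; an end $[E_k]$ is an equivalence class of chains, and its impression $I[E_k]$ is the impression of any representative chain. $\partial_E\Omega$ is the set of all ends. A singleton end is an end whose impression is a single point. Topology on $\Omega\cup\partial_E\Omega$: a sequence of points $\{x_n\}$ in $\Omega$ converges to the end $[E_k]$ if for all $k$ there is $n_k$ with $x_n\in E_k$ whenever $n\ge n_k$. A sequence of ends $\{[E_k^n]\}_{n=1}^\infty$ converges to the end $[E_k^\infty]$ if for every $k$ there is $n_k$ such that for each $n\ge n_k$ there is $l_{n,k}$ with $E^n_{l_{n,k}}\subset E_k^\infty$. Points of $\Omega$ converge to points of $\Omega$ as in the metric topology, and no sequence of ends converges to a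 point of $\Omega$. A set $C\subset\Omega\cup\partial_E\Omega$ is closed if every $y\in\Omega\cup\partial_E\Omega$ which is a limit of a sequence in $C$ belongs to $C$. $\Omega\cup\partial_{SP}\Omega$ carries the induced topology. Mazurkiewicz boundary: for $x,y\in\Omega$, $d_M(x,y)=\inf\operatorname{diam}E$, the infimum over all connected sets $E\subset\Omega$ containing $x$ and $y$; this is a metric on $\Omega$. $\overline\Omega^M$ is the completion of $(\Omega,d_M)$ (with $\Omega$ identified with its image, and with the extended metric $d_M$), and $\partial_M\Omega=\overline\Omega^M\setminus\Omega$. *)

(* Defs.v *)
From HB Require Import structures.
From mathcomp Require Import all_boot all_order all_algebra.
From mathcomp Require Import all_classical all_reals all_analysis.
From mathcomp Require Import measurable_realfun.

Set Implicit Arguments.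
Unset Strict Implicit.
Unset Printing Implicit Defensive.

Import Order.TTheory GRing.Theory Num.Theory.
Import numFieldNormedType.Exports.

Local Open Scope classical_set_scope.
Local Open Scope ring_scope.

#[short(type="completeMetricType")]
HB.structure Definition CompleteMetric (R : numDomainType) :=
  {T of Metric R T & CompletePseudoMetric R T}.

Notation borel X := (g_sigma_algebraType (@open X)).

Section metric_notions.
Context {R : realType} {X : metricType R}.
Implicit Types A B E : set X.

Definition metric_bounded A := exists x r, A `<=` ball x r.

(* Only used for nonempty sets: [diam set0] is [-oo]. *)
Definition diam A : \bar R :=
  ereal_sup [set (mdist z.1 z.2)%:E | z in A `*` A].

(* The distance to the empty set is [+oo]. *)
Definition set_dist A B : \bar R :=
  ereal_inf [set (mdist z.1 z.2)%:E | z in A `*` B].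

Definition boundary A : set X := closure A `\` interior A.

Definition curve_length (g : R -> X) (a b : R) : \bar R :=
  ereal_sup [set (\sum_(0 <= i < size s)
      mdist (g (nth b (a :: s) i)) (g (nth b (a :: s) i.+1)))%:E
    | s in itv_partition a b].

End metric_notions.

(* A nonconstant rectifiable curve parameterized by arc length. The values of
   [curve_path] outside [0, curve_len] are irrelevant; its continuity on that
   interval follows from [curve_arc_length]. *)
Record curve (R : realType) (X : metricType R) := Curve {
  curve_len : R;
  curve_path :> R -> X;
  curve_len_gt0 : 0 < curve_len;
  curve_arc_length : forall s t, 0 <= s -> s <= t -> t <= curve_len ->
    curve_length curve_path s t = (t - s)%:E
}.

Section newtonian_spaces.
Context {R : realType} {X : completeMetricType R}.
Variables (p : R) (mu : {measure set (borel X) -> \bar R}).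
Local Open Scope ereal_scope.
Implicit Types (u g : borel X -> \bar R) (c : curve X).

Definition curve_integral g c : \bar R :=
  \int[lebesgue_measure]_(t in `[0%R, curve_len c]) g (c t).

Definition nonneg_borel g := measurable_fun [set: borel X] g /\ forall x, 0 <= g x.

Definition upper_gradient_on u g c :=
  if (u (c 0%R) \is a fin_num) && (u (c (curve_len c)) \is a fin_num)
  then is_true (`|u (c 0%R) - u (c (curve_len c))| <= curve_integral g c)
  else curve_integral g c = +oo.

Definition upper_gradient u g :=
  nonneg_borel g /\ forall c, upper_gradient_on u g c.

Definition energy g : \bar R := \int[mu]_x (g x `^ p).

Definition exceptional (G : set (curve X)) := exists rho,
  [/\ nonneg_borel rho, energy rho < +oo
    & forall c, G c -> curve_integral rho c = +oo].

Definition weak_upper_gradient u g := nonneg_borel g /\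
  exists2 G, exceptional G & forall c, ~ G c -> upper_gradient_on u g c.

Definition newtonian u := measurable_fun [set: borel X] u /\
  energy (fun x => `|u x|) + ereal_inf [set energy g | g in upper_gradient u]
    < +oo.

Definition is_minimal_weak_upper_gradient u g :=
  [/\ weak_upper_gradient u g, energy g < +oo
    & forall h, weak_upper_gradient u h -> energy h < +oo ->
        {ae mu, forall x, g x <= h x}].

(* A function [g_u] as above exists, and is unique up to a null set, for each
   [u] in the Newtonian space; the default value of [xget] is a dummy. *)
Definition minimal_weak_upper_gradient u : borel X -> \bar R :=
  xget (fun=> 0) (is_minimal_weak_upper_gradient u).

Definition mean (A : set X) u : \bar R :=
  (fine (mu A))^-1%:E * \int[mu]_(x in A) u x.

Definition poincare := exists C lambda : R,
  [/\ (0 < C)%R, (1 <= lambda)%R & forall (x : X) (r : R) u,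
    (0 < r)%R -> newtonian u ->
    mean (ball x r) (fun y => `|u y - mean (ball x r) u|) <=
      C%:E * diam (ball x r) *
      mean (ball x (lambda * r)%R)
        (fun y => minimal_weak_upper_gradient u y `^ p) `^ p^-1].

Definition doubling := exists2 C : R, (0 < C)%R &
  forall (x : X) (r : R), (0 < r)%R ->
    mu (ball x (2 * r)%R) <= C%:E * mu (ball x r).

Definition finite_positive_on_balls := forall (x : X) (r : R),
  (0 < r)%R -> 0 < mu (ball x r) < +oo.

End newtonian_spaces.

Section ends.
Context {R : realType} {X : metricType R}.
Variable Omega : set X.
Implicit Types E F : nat -> set X.

Definition bounded_domain :=
  [/\ metric_bounded Omega, Omega !=set0, connected Omega & open Omega].

Definition acceptable (A : set X) :=
  [/\ metric_bounded A, connected A, A `<` Omega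
    & closure A `&` boundary Omega !=set0].

Definition impression E : set X := \bigcap_k closure (E k).

Definition chain E :=
  [/\ forall k, acceptable (E k),
      forall k, E k.+1 `<=` E k,
      forall k, (0 < set_dist (Omega `&` boundary (E k.+1))
                              (Omega `&` boundary (E k)))%E
    & impression E `<=` boundary Omega].

Definition divides E F := forall k, exists l, E l `<=` F k.

Definition chain_equiv E F := divides E F /\ divides F E.

Definition ends : set (set (nat -> set X)) :=
  [set [set F | chain F /\ chain_equiv E F] | E in chain].

Definition singleton_end (e : ends) :=
  exists x, forall E, \val e E -> impression E = [set x].

Definition points_cvg_end (x : nat -> Omega) (e : ends) :=
  forall E, \val e E -> forall k, exists N, forall n, (N <= n)%N ->
    E k (\val (x n)).

Definition ends_cvg_end (f : nat -> ends) (e : ends) :=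
  forall E, \val e E -> forall k, exists N, forall n, (N <= n)%N ->
    forall F, \val (f n) F -> exists l, F l `<=` E k.

Definition end_space : Type := (Omega + ends)%type.

(* Only sequences of points and sequences of ends have limits. *)
Definition end_space_lim (s : nat -> end_space) (y : end_space) :=
  match y with
  | inl a => exists2 x : nat -> Omega, s = inl \o x &
               (fun n => \val (x n)) @ \oo --> \val a
  | inr e => (exists2 x : nat -> Omega, s = inl \o x & points_cvg_end x e) \/
             (exists2 f : nat -> ends, s = inr \o f & ends_cvg_end f e)
  end.

Definition end_space_closed (C : set end_space) :=
  forall s y, (forall n, C (s n)) -> end_space_lim s y -> C y.

Lemma end_space_lim_sub s y (h : nat -> nat) : (forall n, n <= h n)%N ->
  end_space_lim s y -> end_space_lim (s \o h) y.
Proof.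
move=> hn; case: y => [a|e] /=.
- move=> [x -> xa]; exists (x \o h) => //.
  apply: cvg_trans xa => A [N _ NA]; exists N => // n /= Nn.
  by apply: NA => /=; exact: leq_trans (hn n).
- move=> [[x -> xe]|[f -> fe]]; [left; exists (x \o h)|right; exists (f \o h)] => //.
  + move=> E eE k; have [N NE] := xe E eE k; exists N => n Nn.
    by apply: NE; exact: leq_trans (hn n).
  + move=> E eE k; have [N NE] := fe E eE k; exists N => n Nn.
    by apply: NE; exact: leq_trans (hn n).
Qed.

Lemma end_space_closedU C D : end_space_closed C -> end_space_closed D ->
  end_space_closed (C `|` D).
Proof.
move=> cC cD s y sCD sy.
have [infC|] := pselect (forall n, exists m, (n <= m)%N /\ C (s m)).
  have [h hP] := choice infC; left; apply: (cC (s \o h)).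
    by move=> n; case: (hP n).
  by apply: end_space_lim_sub => // n; case: (hP n).
move=> /existsNP[N NC]; right; apply: (cD (s \o addn N)).
  move=> n; have [Cn|//] := sCD (N + n)%N; exfalso; apply: NC.
  by exists (N + n)%N; split => //; exact: leq_addr.
by apply: end_space_lim_sub => // n; exact: leq_addl.
Qed.

Let end_space_open : set_system end_space :=
  [set U | end_space_closed (~` U)].

Let end_space_openT : end_space_open setT.
Proof. by move=> s y sC; have := sC 0%N => /(_ I). Qed.

Let end_space_openI : setI_closed end_space_open.
Proof.
by move=> U V oU oV; rewrite /end_space_open /= setCI; exact: end_space_closedU.
Qed.

Let end_space_open_bigU (I : Type) (f : I -> set end_space) :
  (forall i, end_space_open (f i)) -> end_space_open (\bigcup_i f i).
Proof.
move=> of_ s y sC sy [i _ fiy]; apply: (of_ i s y _ sy) => // n fis.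
by apply: (sC n); exists i.
Qed.

HB.instance Definition _ := Choice.on end_space.
HB.instance Definition _ := isOpenTopological.Build end_space
  end_space_openT end_space_openI end_space_open_bigU.

Lemma end_space_closedP (C : set end_space) : closed C <-> end_space_closed C.
Proof. by rewrite -openC /open /= /end_space_open /= setCK. Qed.

Definition singleton_end_space : set end_space :=
  [set y | if y is inr e then singleton_end e else True].

Definition mazurkiewicz_dist (x y : X) : \bar R :=
  ereal_inf [set diam E | E in
    [set E : set X | [/\ connected E, E `<=` Omega, E x & E y]]].

(* Metric completions are unique up to a unique isometry fixing [Omega]. *)
Definition mazurkiewicz_completion (Y : completeMetricType R)
    (iota : Omega -> Y) :=
  (forall x y : Omega,
     (mdist (iota x) (iota y))%:E = mazurkiewicz_dist (\val x) (\val y)) /\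
  dense (range iota).

End ends.

Arguments singleton_end_space {R X} Omega _.

Definition homeomorphism (S T : topologicalType) (f : S -> T) :=
  continuous f /\ exists g, [/\ cancel f g, cancel g f & continuous g].

(* Main.v *)
(** The Poincaré inequality enters only through local connectedness. Fix [x] and
    [e], and let [U] be the set of points reachable from [x] by steps shorter
    than [e] inside a ball of radius [2 l s], where [l] is the dilation constant
    of the inequality. The indicator of [U], multiplied by a radial plateau
    function, is a Newtonian function with an upper gradient supported in the
    shell between the radii [l s] and [2 l s]; the inequality on the ball of
    radius [s] makes it constant there, so that ball lies in [U], for every [e].
    Doubling makes closed balls compact, and in a compact set two points joined
    by chains of arbitrarily small steps lie in a common connected subset.

    A singleton end shrinks to a point, by compactness, hence has a limit [z] in
    the Mazurkiewicz completion. Its chains are then neighborhood bases of [z],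
    in the sense that each [E k] contains all points of [Omega] close to [z]: a small
    connected set reaching from [E k.+1] out of [E k] would join the separated
    boundaries of the two. This gives injectivity and both continuity statements.
    Conversely, a boundary point [z] of the completion lies over a point [x] of the
    boundary of [Omega], and the components of [Omega `&` ball x r] containing
    the points close to [z] form a chain converging to [z], because local
    connectedness makes these components open. *)

Require Import Defs.
From HB Require Import structures.
From mathcomp Require Import all_boot all_order all_algebra.
From mathcomp Require Import measurable_realfun.
From mathcomp Require Import all_classical all_reals all_analysis.
From mathcomp Require Import ring lra.

Set Implicit Arguments.
Unset Strict Implicit.
Unset Printing Implicit Defensive.

Import Order.TTheory GRing.Theory Num.Theory.
Import numFieldNormedType.Exports.

Local Open Scope classical_set_scope.
Local Open Scope ring_scope.

(** * Metric spaces *)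

Lemma invSn_lt (R : realType) (e : R) : 0 < e ->
  exists N, forall n, (N <= n)%N -> n.+1%:R^-1 < e.
Proof.
move=> e0; exists (Num.truncn e^-1) => n Nn.
rewrite -[ltRHS]invrK ltf_pV2 ?posrE ?invr_gt0//.
by apply: (lt_le_trans (truncnS_gt _)); rewrite ler_nat.
Qed.

Section metric_topology.
Context {R : realType} {X : metricType R}.
Implicit Types (A B U : set X) (x y z : X).

Lemma mdist_ball_open x r : open (ball x r).
Proof.
rewrite openE => y; rewrite ballEmdist /= => xyr.
apply/nbhs_ballP; exists (r - mdist x y) => /=; first by rewrite subr_gt0.
move=> z; rewrite !ballEmdist /= => yz.
by have := metric_triangle x y z; lra.
Qed.

Lemma open_mdistP U :
  open U <-> forall x, U x -> exists2 r, 0 < r & forall y, mdist x y < r -> U y.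
Proof.
rewrite openE; split=> UU x /UU; rewrite /interior.
  by move=> /nbhs_ballP[r r0 rU]; exists r => // y; have := rU y; rewrite ballEmdist.
move=> [r r0 rU]; apply/nbhs_ballP; exists r => // y.
by rewrite ballEmdist; exact: rU.
Qed.

Lemma closure_mdistP A x :
  closure A x <-> forall r, 0 < r -> exists2 a, A a & mdist x a < r.
Proof.
split=> [Ax r r0|Ax B /nbhs_ballP[r /= r0 rB]].
  have [a [Aa]] := Ax _ (nbhsx_ballx x r r0).
  by rewrite ballEmdist => xa; exists a.
have [a Aa xa] := Ax _ r0; exists a; split=> //.
by apply: rB; rewrite ballEmdist.
Qed.

Lemma cvg_mdistP (u : nat -> X) x : (u @ \oo --> x) <->
  forall e : R, 0 < e -> exists N, forall n, (N <= n)%N -> mdist x (u n) < e.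
Proof.
split.
  move=> /metricType_numDomainType.cvgrPdist_lt ux e e0.
  by have [N _ NP] := ux e e0; exists N => n /NP.
move=> ux; apply/metricType_numDomainType.cvgrPdist_lt => e e0.
by have [N NP] := ux e e0; exists N => // n /NP.
Qed.

Lemma compact_seq_cluster K (u : nat -> X) : compact K -> (forall n, K (u n)) ->
  exists2 x, K x & forall (e : R) N, 0 < e -> exists2 n, (N <= n)%N & mdist x (u n) < e.
Proof.
move=> cK Ku.
have [x [Kx clx]] : K `&` cluster (u @ \oo) !=set0.
  by apply: cK; exists 0%N => // n _; exact: Ku.
exists x => // e N e0.
have [] := clx [set u n | n in [set n | (N <= n)%N]] (ball x e).
- by exists N => // n Nn; exists n.
- exact: nbhsx_ballx.
by move=> y [[n Nn <-]]; rewrite ballEmdist => xe; exists n.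
Qed.

End metric_topology.

Lemma cauchy_seq_cvg (R : realType) (X : completeMetricType R) (u : nat -> X) :
  (forall e : R, 0 < e -> exists N, forall n m, (N <= n)%N -> (N <= m)%N ->
     mdist (u n) (u m) < e) ->
  exists x, forall e : R, 0 < e -> exists N, forall n, (N <= n)%N -> mdist x (u n) < e.
Proof.
move=> uC.
have : cvg (u @ \oo).
  apply: cauchy_cvg; apply: cauchy_exP => e e0.
  have [N NP] := uC e e0; exists (u N); exists N => // n Nn.
  by rewrite /= ballEmdist /=; exact: NP.
move=> /cvg_ex[x ux]; exists x.
exact/cvg_mdistP.
Qed.

(** * Chains of small steps in compact sets *)

Section chains_of_small_steps.
Context {R : realType} {X : metricType R}.

(** Existence of a finite chain of steps, encoded as membership in the smallest set closed under
    such steps; proofs supply an invariant set [V] in place of explicit sequences. *)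
Definition chainable (K : set X) (e : R) (x y : X) := forall V : set X, V x ->
  (forall a b, V a -> K b -> mdist a b < e -> V b) -> V y.

Lemma chainable_refl K e x : chainable K e x x.
Proof. by move=> V. Qed.

Lemma chainable_step K e x y z :
  chainable K e x y -> K z -> mdist y z < e -> chainable K e x z.
Proof. by move=> xy Kz yz V Vx VV; apply: (VV y) => //; exact: xy. Qed.

Lemma chainable_sub K e x y : K x -> chainable K e x y -> K y.
Proof. by move=> Kx xy; apply: xy. Qed.

Lemma chainableW K K' e e' x y : K `<=` K' -> e <= e' ->
  chainable K e x y -> chainable K' e' x y.
Proof.
move=> KK' ee' xy V Vx VV; apply: xy => // a b Va Kb ab.
by apply: (VV a) => //; [exact: KK'|exact: lt_le_trans ee'].
Qed.

(* A limit of chainable points is chainable; if the set of points chainable for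
   every step size fell apart into two pieces, chains with shrinking steps would
   leave points in the gap between them, accumulating there. *)
Lemma chainable_connected K x y : compact K -> K x ->
  (forall e : R, 0 < e -> chainable K e x y) ->
  exists C, [/\ connected C, C `<=` K, C x & C y].
Proof.
move=> cK Kx xy.
pose Q := [set z | forall e : R, 0 < e -> chainable K e x z].
have QK : Q `<=` K by move=> z /(_ 1 ltr01); exact: chainable_sub.
have Qlim (u : nat -> X) : (forall n, chainable K n.+1%:R^-1 x (u n)) ->
    exists2 z, Q z & forall (e : R) N, 0 < e -> exists2 n, (N <= n)%N & mdist z (u n) < e.
  move=> uQ; have Ku n : K (u n) by exact: chainable_sub (uQ n).
  have [z Kz zu] := compact_seq_cluster cK Ku; exists z => // e e0.
  have [N Ne] : exists N, N.+1%:R^-1 < e.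
    exists (Num.truncn e^-1); rewrite -[ltRHS]invrK ltf_pV2 ?posrE ?invr_gt0//.
    exact: truncnS_gt.
  have [n Nn zn] := zu e N e0.
  apply: (@chainable_step _ _ _ (u n)) => //; last by rewrite metric_sym.
  apply: chainableW (uQ n) => //; apply: le_trans (ltW Ne).
  by rewrite lef_pV2 ?posrE// ler_nat.
exists Q; split=> //; last first.
  by move=> e _; exact: chainable_refl.
have clQ : closed Q.
  move=> z /closure_mdistP zQ e e0.
  have [q Qq zq] := zQ e e0; apply: (@chainable_step _ _ _ q); first exact: Qq.
    have : closure Q z by exact/closure_mdistP.
    move=> /(closureS QK).
    by rewrite -(closure_id _).1//; apply: compact_closed => //; exact: metric_hausdorff.
  by rewrite metric_sym.
move=> B [b0 Bb0] [G oG BG] [F cF BF].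
have cB : closed B by rewrite BF; exact: closedI.
have cD : closed (Q `\` B).
  rewrite BG setDIr setDv set0U setDE; apply: closedI => //; exact: open_closedC.
(* A relatively clopen [B] splits [Q] into two closed pieces. The claim is applied to [B] and its
   complement in the order that puts [x] in the first piece. *)
have gap (A D : set X) : closed A -> closed D -> A `|` D = Q -> A x -> A `&` D = set0 ->
    D = set0.
  move=> clA clD ADQ Ax AD0.
  apply/seteqP; split=> // q Dq; exfalso.
  have cptA : compact A.
    by apply: (subclosed_compact clA cK) => a Aa; apply: QK; rewrite -ADQ; left.
  have [d d0 dP] : exists2 d, 0 < d & forall a p, A a -> D p -> d <= mdist a p.
    apply: contrapT => /forall2NP H.
    have H' n : exists ap : X * X, [/\ A ap.1, D ap.2 & mdist ap.1 ap.2 < n.+1%:R^-1].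
      have [/negP|/existsNP[a /existsNP[p /not_implyP[Aa /not_implyP[Dp /negP]]]]] :=
        H n.+1%:R^-1.
        by rewrite invr_gt0 ltr0Sn.
      by rewrite -ltNge => ap; exists (a, p).
    have [w wP] := choice H'.
    have [a Aa aw] := @compact_seq_cluster _ _ A (fun n => (w n).1) cptA
      (fun n => let: And3 h _ _ := wP n in h).
    suff : closure D a.
      rewrite -(closure_id _).1// => Da.
      by have : set0 a by rewrite -AD0.
    apply/closure_mdistP => e e0.
    have e20 : 0 < e / 2 by rewrite divr_gt0.
    have [N Ne] := invSn_lt e20.
    have [n Nn an] := aw (e / 2) N e20.
    have [_ Dn wn] := wP n; exists (w n).2 => //.
    move: an wn (Ne n Nn) (metric_triangle a (w n).1 (w n).2) => /=.
    by move: (n.+1%:R^-1 : R) => q'; lra.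
  have d30 : 0 < d / 3 by rewrite divr_gt0.
  pose near s := [set z | exists2 a, A a & mdist a z < s].
  (* [z] is the first point of a chain towards [q] at distance at least [d / 3] from [A]; a short
     step leaves it within [2 * d / 3]. An accumulation point of such exit points can lie neither in
     [A] nor in [D]. *)
  have H s : 0 < s -> exists z,
      [/\ chainable K s x z, ~ near (d / 3) z & s < d / 3 -> near (d / 3 + d / 3) z].
    move=> s0.
    apply: contrapT => /forallNP H.
    have Qq : Q q by rewrite -ADQ; right.
    have : (chainable K s x `&` near (d / 3)) q.
      apply: (Qq s) => //.
        split; first exact: chainable_refl.
        by exists x => //; rewrite mdistxx.
      move=> a b [xa [c Ac ca]] Kb ab.
      have xb := chainable_step xa Kb ab.
      split => //; apply: contrapT => nb; apply: (H b); split=> // nd.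
      by exists c => //; have := metric_triangle c a b; lra.
    move=> [_ [a Aa]]; have := dP _ _ Aa Dq; lra.
  have [u uP] := choice (fun n => H n.+1%:R^-1 ltac:(by rewrite invr_gt0)).
  have [z Qz zu] := Qlim u (fun n => let: And3 h _ _ := uP n in h).
  have [N Nd] := invSn_lt d30.
  have [n Nn zn] := zu (d / 3) N d30.
  have [_ un nu] := uP n; have nd := Nd n Nn.
  move: Qz; rewrite -ADQ => -[Az|Dz].
    by apply: un; exists z.
  have [a Aa au] := nu nd.
  have := dP _ _ Aa Dz; have := metric_triangle a (u n) z.
  by rewrite (metric_sym (u n) z); lra.
have BQ : B `<=` Q by rewrite BG => z [].
have Qx : Q x by move=> e _; exact: chainable_refl.
have BDQ : B `|` (Q `\` B) = Q.
  apply/seteqP; split=> [z [/BQ|[]]//|z Qz].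
  by have [Bz|Bz] := pselect (B z); [left|right].
have BD0 : B `&` (Q `\` B) = set0 by rewrite setDE setICA setICr setI0.
have [Bx|Bx] := pselect (B x).
  by rewrite -BDQ (gap B (Q `\` B))// setU0.
have B0 := gap _ _ cD cB (eq_trans (setUC _ _) BDQ) (conj Qx Bx) (eq_trans (setIC _ _) BD0).
by move: Bb0; rewrite B0.
Qed.

End chains_of_small_steps.

(** * Compactness of closed balls from doubling *)

Lemma totally_bounded_compact (R : realType) (X : completeMetricType R) (K : set X) :
  closed K ->
  (forall e : R, 0 < e -> exists s : seq X, K `<=` [set y | has (fun a => mdist a y < e) s]) ->
  compact K.
Proof.
move=> cK tbK; rewrite compact_ultra => F FU FK /=.
have [x Fx] : exists x : X, F --> x.
  apply/cvg_ex; apply: cauchy_cvg; apply: cauchy_exP => e e0.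
  have [s Ks] := tbK e e0.
  have {Ks} : F [set y | has (fun a => mdist a y < e) s] by exact: filterS FK.
  (* An ultrafilter containing a finite union of balls contains one of them, so [F] is Cauchy. *)
  elim: s => [F0|a s IH].
    by exfalso; apply: (@filter_not_empty _ F); apply: filterS F0.
  have [Fa _|Fa /= Fas] := in_ultra_setVsetC (ball a e) FU; first by exists a.
  apply: IH; apply: filterS2 Fa Fas => y; rewrite ballEmdist /=.
  by move=> /negP/negbTE ->.
exists x; split=> //.
by apply: (@closed_cvg X X F _ id K cK _ x Fx); exact: FK.
Qed.

Section doubling_measures.
Context {R : realType} {X : completeMetricType R}.
Variable mu : {measure set (borel X) -> \bar R}.
Hypothesis mu_ball : finite_positive_on_balls mu.

Lemma measurable_open (U : set X) : open U -> measurable (U : set (borel X)).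
Proof. exact: sub_sigma_algebra. Qed.

Lemma measurable_ball_borel (x : X) r : measurable (ball x r : set (borel X)).
Proof. apply: measurable_open; exact: mdist_ball_open. Qed.

Hypothesis mu_doubling : doubling mu.

Lemma doubling_iter : exists2 C : R, 0 < C & forall (x : X) r k, 0 < r ->
  (mu (ball x (2 ^+ k * r)) <= (C ^+ k)%:E * mu (ball x r))%E.
Proof.
have [C C0 CP] := mu_doubling; exists C => // x r k r0.
elim: k => [|k IH]; first by rewrite !expr0 mul1r mul1e.
rewrite exprS -mulrA; apply: (le_trans (CP _ _ _)); first by rewrite mulr_gt0 ?exprn_gt0.
by rewrite exprS EFinM -muleA lee_pmul2l.
Qed.

(** Volume count: the balls of radius [e / 2] about the points are disjoint, lie in
    [ball x (r + e)], and by doubling each carries at least a fixed fraction of its measure. *)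
Lemma separated_size_bounded (x : X) (r e : R) : 0 < e -> exists N, forall s : seq X,
  all (fun a => mdist x a <= r) s -> pairwise (fun a b => e <= mdist a b) s ->
  (size s <= N)%N.
Proof.
move=> e0; have [r0|r0] := ltP r 0.
  exists 0%N => -[//|a s] /= /andP[xa _].
  by have := le_lt_trans xa r0; rewrite ltNge mdist_ge0.
have e20 : 0 < e / 2 by rewrite divr_gt0.
have [C C0 CP] := doubling_iter.
(* After [k] doublings, a ball of radius [e / 2] about a point within [r] of [x] covers
   [ball x (r + e)]. *)
have [k kP] : exists k, r + (r + e) <= 2 ^+ k * (e / 2).
  exists (Num.truncn ((r + (r + e)) / (e / 2))).+1.
  rewrite -ler_pdivrMr//; apply: (le_trans (ltW (truncnS_gt _))).
  by rewrite -natrX ler_nat ltnW// ltn_expl.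
have re0 : 0 < r + e by lra.
have /andP[M0 Moo] := mu_ball x re0.
set M := fine (mu (ball x (r + e))).
have ME : mu (ball x (r + e)) = M%:E by rewrite fineK// ge0_fin_numE.
have Mpos : 0 < M by rewrite -lte_fin -ME.
set c := M / C ^+ k.
have c0 : 0 < c by rewrite divr_gt0 ?exprn_gt0.
have cP a : mdist x a <= r -> (c%:E <= mu (ball a (e / 2)))%E.
  move=> xa; rewrite /c mulrC EFinM lee_pdivrMl ?exprn_gt0// -ME.
  apply: le_trans (CP _ _ _ e20); apply: le_measure;
    rewrite ?inE; try exact: measurable_ball_borel.
  move=> y; rewrite !ballEmdist /= => xy; apply: lt_le_trans kP.
  by have := metric_triangle a x y; rewrite (metric_sym a x); lra.
exists (Num.truncn (M / c)) => s sx ss.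
have mU (t : seq X) : measurable (\big[setU/set0]_(a <- t) ball a (e / 2) : set (borel X)).
  by apply: bigsetU_measurable => a _; exact: measurable_ball_borel.
have : ((c *+ size s)%:E <= M%:E)%E.
  rewrite -ME.
  apply: (@le_trans _ _ (mu (\big[setU/set0]_(a <- s) ball a (e / 2)))); last first.
    apply: le_measure; rewrite ?inE; [exact: mU|exact: measurable_ball_borel|].
    move=> y; rewrite -bigcup_seq => -[a /= /(allP sx) /= xa].
    rewrite !ballEmdist /= => ay; have := metric_triangle x a y; lra.
  elim: s sx ss => [_ _|a s IH /= /andP[xa sx] /andP[sa ss]].
    by rewrite mulr0n measure_ge0.
  rewrite big_cons measureU; last 1 first.
  - apply/seteqP; split=> // y [ay]; rewrite -bigcup_seq => -[b /= /(allP sa) /=].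
    rewrite !ballEmdist /= in ay * => ab yb.
    have := metric_triangle a y b; rewrite (metric_sym y b); lra.
  - by rewrite mulrS EFinD leeD// ?cP//; exact: IH.
  - exact: measurable_ball_borel.
  - exact: mU.
rewrite lee_fin -mulr_natl -ler_pdivlMr// => ?.
by rewrite truncn_ge_nat// divr_ge0// ltW.
Qed.

(** Without a finite [e]-net, an [e]-separated family could be extended point by point beyond the
    bound of [separated_size_bounded]. *)
Lemma mdist_closed_ball_compact (x : X) r : compact [set y : X | mdist x y <= r].
Proof.
apply: totally_bounded_compact => [|e e0].
  move=> y /closure_mdistP cy; apply/ler_addgt0Pr => d d0.
  have [a /= xa ya] := cy d d0.
  by have := metric_triangle x a y; rewrite (metric_sym a); lra.
have [N NP] := separated_size_bounded x r e0.
apply: contrapT => /forallNP Hs.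
suff [s [sx ss sN]] : exists s : seq X, [/\ all (fun a => mdist x a <= r) s,
    pairwise (fun a b => e <= mdist a b) s & size s = N.+1].
  by have := NP s sx ss; rewrite sN ltnn.
elim: N.+1 => [|n [s [sx ss <-]]]; first by exists [::].
have /existsNP[y /not_implyP[/= xy /negP/hasPn ys]] := Hs s.
exists (y :: s); split=> //=; first by rewrite xy.
rewrite ss andbT; apply/allP => b /ys.
by rewrite -leNgt metric_sym.
Qed.

End doubling_measures.
(** * Local connectedness from the Poincaré inequality *)

(** The integral of a nonnegative function is a supremum over the simple functions below it, and a
    larger function has more of these. This applies directly to gradients composed with a curve. *)
Lemma ge0_le_integral_pointwise d (T : measurableType d) (R : realType)
    (mu : {measure set T -> \bar R}) (D : set T) (f g : T -> \bar R) :
  (forall x, D x -> 0 <= f x)%E -> (forall x, D x -> f x <= g x)%E ->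
  (\int[mu]_(x in D) f x <= \int[mu]_(x in D) g x)%E.
Proof.
move=> f0 fg; rewrite !ge0_integralE//; last first.
  by move=> x Dx; exact: le_trans (f0 x Dx) (fg x Dx).
apply: ereal_sup_le => _ [h /= hf <-]; exists h => // x.
apply: le_trans (hf x) _; rewrite !patchE; case: ifPn => // /set_mem.
exact: fg.
Qed.

(** * Lipschitz paths: chainability and level crossings *)

Section lipschitz_paths.
Context {R : realType}.

Definition lipschitz_path {X : metricType R} (g : R -> X) (a b : R) :=
  forall s t, a <= s -> s <= t -> t <= b -> mdist (g s) (g t) <= t - s.

Lemma lipschitz_path_rev {X : metricType R} (g : R -> X) a b :
  lipschitz_path g a b -> lipschitz_path (fun t => g (a + b - t)) a b.
Proof.
move=> gl s t sa st tb; rewrite metric_sym.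
by have := gl (a + b - t) (a + b - s); lra.
Qed.

Lemma lipschitz_path_chainable {X : metricType R} (g : R -> X) a b (K : set X) e :
  lipschitz_path g a b -> a <= b -> 0 < e ->
  (forall t, a <= t <= b -> K (g t)) -> chainable K e (g a) (g b).
Proof.
move=> gl ab e0 Kg.
(* Induction on the number of steps of length [e / 2]; once less than [e] remains, a single step
   reaches [g b]. *)
suff H n s : a <= s -> s <= b -> b - s <= n%:R * (e / 2) -> chainable K e (g s) (g b).
  apply: (H (Num.truncn ((b - a) / (e / 2))).+1) => //.
  by rewrite -ler_pdivrMr ?divr_gt0//; exact/ltW/truncnS_gt.
elim: n s => [|n IH] s sa sb sn.
  have -> : s = b by apply/eqP; rewrite eq_le sb /=; lra.
  exact: chainable_refl.
have [bs|bs] := ltP (b - s) e.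
  apply: (@chainable_step _ _ _ _ _ (g s)); first exact: chainable_refl.
    by apply: Kg; rewrite ab lexx.
  by apply: le_lt_trans bs; exact: gl.
have H : chainable K e (g (s + e / 2)) (g b).
  by apply: IH; [lra|lra|rewrite -natr1 in sn; lra].
move=> V Vs VV; apply: H => //; apply: VV Vs _ _; first by apply: Kg; lra.
by apply: (le_lt_trans (gl _ _ _ _ _)); lra.
Qed.

(** [t] is the first time at which [f] is at least [hi], and [s] the last time before [t] at which
    [f] is at most [lo]. Continuity makes both attained, and the Lipschitz bound gives
    [hi - lo <= t - s]. *)
Lemma crossing (f : R -> R) a b lo hi :
  (forall s t, a <= s -> s <= t -> t <= b -> `|f t - f s| <= t - s) ->
  a <= b -> f a <= lo -> lo < hi -> hi <= f b ->
  exists s t, [/\ a <= s, t <= b, hi - lo <= t - s &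
    forall u, s < u -> u < t -> lo < f u < hi].
Proof.
move=> fl ab fa lohi fb.
pose T := [set u | a <= u <= b /\ hi <= f u].
have Tb : T b by split; rewrite ?ab ?lexx.
have lT : lbound T a by move=> u [/andP[]].
have iT : has_inf T by split; [exists b|exists a].
set t := inf T.
have atb : a <= t <= b 
  by apply/andP; split; [apply: lb_le_inf => //; exists b|apply: ge_inf => //; exists a].
have ft : hi <= f t.
  apply/ler_addgt0Pr => e e0; have [u [/andP[au ub] hu] ut] := inf_adherent e0 iT.
  have tu : t <= u by apply: ge_inf => //; [exists a|split => //; rewrite au].
  have := fl t u; rewrite ler_norml; move: atb => /andP[-> _] => /(_ isT tu ub) /andP[_].
  by rewrite -/t in ut; lra.
pose S := [set u | a <= u <= t /\ f u <= lo].
move: atb => /andP[at_ tb].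
have Sa : S a by split; rewrite ?at_ ?lexx.
have uS : ubound S t by move=> u [/andP[]].
have sS : has_sup S by split; [exists a|exists t].
set s := sup S.
have ast : a <= s <= t 
  by apply/andP; split; [apply: ub_le_sup => //; exists t|apply: ge_sup => //; exists a].
move: ast => /andP[as_ st].
have fs : f s <= lo.
  apply/ler_addgt0Pr => e e0; have [u [/andP[au ub] hu] ut] := sup_adherent e0 sS.
  have us : u <= s by apply: ub_le_sup => //; [exists t|split => //; rewrite au].
  have := fl u s au us; rewrite ler_norml => /(_ (le_trans st tb)) /andP[_].
  by rewrite -/s in ut; lra.
exists s, t; split => //.
  by have := fl s t as_ st tb; rewrite ler_norml => /andP[_]; lra.
move=> u su ut; rewrite !ltNge; apply/andP; split; apply/negP => fu.
  have : u <= s by apply: ub_le_sup; [exists t|split => //; apply/andP; split; lra].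
  by lra.
have : t <= u by apply: ge_inf; [exists a|split => //; apply/andP; split; lra].
by lra.
Qed.

End lipschitz_paths.

(** * The radial plateau function *)

Section plateau.
Context {R : realType}.
Variables r0 r : R.
Hypothesis r0r : r0 < r.

Let rr : 0 < r - r0. Proof. by rewrite subr_gt0. Qed.

Definition clamp (t : R) : R := Num.min (Num.max t r0) r.

Definition plateau (t : R) : R := (r - clamp t) / (r - r0).

Variant clamp_spec (t : R) : R -> Type :=
| ClampLo of t <= r0 : clamp_spec t r0
| ClampMid of r0 < t & t <= r : clamp_spec t t
| ClampHi of r < t : clamp_spec t r.

Lemma clampP t : clamp_spec t (clamp t).
Proof.
rewrite /clamp; have [tr0|r0t] := leP t r0.
  by rewrite (min_idPl (ltW r0r)); exact: ClampLo.
by have [tr|rt] := leP t r; [exact: ClampMid|exact: ClampHi].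
Qed.

Lemma clamp_itv t : r0 <= clamp t <= r.
Proof. by have := r0r; case: clampP => *; lra. Qed.

Lemma plateau_ge0 t : 0 <= plateau t.
Proof. by rewrite divr_ge0 ?(ltW rr)// subr_ge0; have /andP[] := clamp_itv t. Qed.

Lemma plateau_le1 t : plateau t <= 1.
Proof. by rewrite ler_pdivrMr// mul1r lerD2l lerN2; have /andP[] := clamp_itv t. Qed.

Lemma plateau1 t : t <= r0 -> plateau t = 1.
Proof.
move=> tr; rewrite /plateau /clamp (max_idPr tr) (min_idPl (ltW r0r)).
by rewrite divff ?gt_eqF.
Qed.

Lemma plateau0 t : r <= t -> plateau t = 0.
Proof.
move=> tr; rewrite /plateau /clamp (max_idPl _) ?(min_idPr tr) ?subrr ?mul0r//.
exact: ltW (lt_le_trans r0r tr).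
Qed.

(** Superlevel sets of the radial plateau are thus balls, which gives the measurability of the
    cutoff. *)
Lemma plateau_gt (a t : R) : 0 <= a ->
  (a < plateau t) = (a < 1) && (t < r - a * (r - r0)).
Proof.
move=> a0; rewrite ltr_pdivlMr// -(ltr_pM2r rr a 1) mul1r.
have : 0 <= a * (r - r0) by rewrite mulr_ge0// ltW.
move: (a * _) => q q0; have := r0r.
by case: clampP => *; apply/idP/idP => [?|/andP[? ?]]; lra.
Qed.

(** This is [crossing] between the clamped values of [f a] and [f b], which lie between [r0] and
    [r], where the plateau has slope [- (r - r0)^-1]. *)
Lemma plateau_crossing (f : R -> R) a b :
  (forall s t, a <= s -> s <= t -> t <= b -> `|f t - f s| <= t - s) ->
  a <= b -> plateau (f b) < plateau (f a) ->
  exists s t, [/\ a <= s, s <= t, t <= b,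
    plateau (f a) - plateau (f b) <= (r - r0)^-1 * (t - s) &
    forall u, s < u -> u < t -> r0 <= f u < r].
Proof.
move=> fl ab; rewrite /plateau ltr_pdivrMr// divfK ?gt_eqF// ltrD2l ltrN2 => clab.
have [||s [t [as_ tb st H]]] := crossing fl ab _ clab.
- by move: clab; have := r0r; case: (clampP (f a)); case: (clampP (f b)) => *; lra.
- by move: clab; have := r0r; case: (clampP (f a)); case: (clampP (f b)) => *; lra.
exists s, t; split=> //.
- by rewrite -subr_ge0; apply: le_trans st; rewrite subr_ge0 ltW.
- by rewrite -mulrBl mulrC ler_pM2l ?invr_gt0//; lra.
- move=> u su ut; have := H u su ut; have := clamp_itv (f a); have := clamp_itv (f b).
  by move: (clamp (f a)) (clamp (f b)) => *; lra.
Qed.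

End plateau.

(** * The cutoff function and its upper gradient *)

Lemma curve_lipschitz (R : realType) (X : metricType R) (c : curve X) :
  lipschitz_path c 0 (curve_len c).
Proof.
move=> s t s0; rewrite le_eqVlt => /predU1P[->|st] tl.
  by rewrite mdistxx subrr.
rewrite -lee_fin -(curve_arc_length s0 (ltW st) tl).
apply: ereal_sup_ubound; exists [:: t]; first exact: itv_partition1.
by rewrite /= big_nat1.
Qed.

Section cutoff.
Context {R : realType} {X : completeMetricType R}.
Variables (p : R) (mu : {measure set (borel X) -> \bar R}).
Hypothesis mu_ball : finite_positive_on_balls mu.
Hypothesis p1 : 1 <= p.
Variables (x : X) (r0 r e : R).
Hypotheses (r00 : 0 < r0) (r0r : r0 < r) (e0 : 0 < e).

Let B : set X := ball x r.
Let U : set X := chainable B e x.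

Let BE y : B y = (mdist x y < r) :> Prop.
Proof. by rewrite /B ballEmdist. Qed.

Let UB : U `<=` B.
Proof. by move=> y; apply: chainable_sub; apply: ballxx; exact: lt_trans r0r. Qed.

Let U_open : open U.
Proof.
apply/open_mdistP => y Uy.
have [d d0 dB] := (open_mdistP B).1 (mdist_ball_open x r) y (UB Uy).
exists (Num.min d e) => [|z]; first by rewrite lt_min d0.
by rewrite lt_min => /andP[yd ye]; apply: chainable_step Uy _ ye; exact: dB.
Qed.

Definition cutoff (y : X) : R :=
  if `[< U y >] then plateau r0 r (mdist x y) else 0.

Definition shell_gradient (y : borel X) : \bar R :=
  if r0 <= mdist x y < r then ((r - r0)^-1)%:E else 0%E.

Let k0 : 0 <= (r - r0)^-1. Proof. by rewrite invr_ge0 subr_ge0 ltW. Qed.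

Let cutoff_ge0 y : 0 <= cutoff y.
Proof. by rewrite /cutoff; case: ifP => // _; exact: plateau_ge0. Qed.

Lemma measurable_cutoff : measurable_fun setT (fun y : borel X => (cutoff y)%:E).
Proof.
apply/measurable_EFinP; apply: (measurability _ (RGenOInfty.measurableE R)).
move=> /= _ [_ [a ->] <-]; rewrite setTI.
have [a0|a0] := ltP a 0.
  rewrite (_ : _ @^-1` _ = setT)//; apply/seteqP; split=> // y _ /=.
  by rewrite in_itv /= andbT; exact: lt_le_trans (cutoff_ge0 y).
have [a1|a1] := ltP a 1; last first.
  rewrite (_ : _ @^-1` _ = set0)//; apply/seteqP; split=> // y /=.
  rewrite in_itv /= andbT /cutoff; case: ifP => _.
    by rewrite ltNge (le_trans (plateau_le1 r0r _)).
  by rewrite ltNge a0.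
(* The remaining levels lie in [[0, 1[], where the superlevel set is open because both [U] and the
   ball are. *)
rewrite (_ : _ @^-1` _ = U `&` ball x (r - a * (r - r0))); last first.
  apply/seteqP; split=> y /=; rewrite in_itv /= andbT /cutoff ballEmdist /=.
    case: asboolP => Uy; last by rewrite ltNge a0.
    by rewrite plateau_gt// => /andP[].
  by move=> [Uy]; rewrite asboolT// plateau_gt// a1.
by apply: measurable_open; apply: openI => //; exact: mdist_ball_open.
Qed.

Lemma shell_gradient_nonneg_borel : nonneg_borel shell_gradient.
Proof.
split; last by move=> y; rewrite /shell_gradient; case: ifP; rewrite ?lee_fin.
apply: measurable_fun_ifT => //; apply: (@measurable_fun_bool _ _ _ _ true).
rewrite setTI (_ : _ @^-1` _ = ball x r `\` ball x r0); last first.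
  apply/seteqP; split=> y /=; rewrite !ballEmdist /=.
    by move=> /andP[ry yr]; split => //; apply/negP; rewrite -leNgt.
  by move=> [yr /negP]; rewrite -leNgt => ->.
by apply: measurableD; exact: measurable_ball_borel.
Qed.

(** A change of the plateau by [h] forces the curve to spend time at least [h * (r - r0)] in the
    shell, where the gradient is [(r - r0)^-1]. Both signs of the change enter the absolute value in
    the upper gradient inequality. *)
Let shell_integral (c : curve X) a b : 0 <= a -> b <= curve_len c -> a <= b ->
  ((plateau r0 r (mdist x (c a)) - plateau r0 r (mdist x (c b)))%:E
     <= curve_integral shell_gradient c)%E /\
  ((plateau r0 r (mdist x (c b)) - plateau r0 r (mdist x (c a)))%:E
     <= curve_integral shell_gradient c)%E.
Proof.
move=> a0 bl ab.
have g0 y : (0 <= shell_gradient y)%E by exact: shell_gradient_nonneg_borel.2.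
have H s t : 0 <= s -> s <= t -> t <= curve_len c ->
    (forall u, s < u -> u < t -> r0 <= mdist x (c u) < r) ->
    (((r - r0)^-1 * (t - s))%:E <= curve_integral shell_gradient c)%E.
  move=> s0 st tl Hst.
  rewrite /curve_integral [leRHS]integral_mkcond.
  apply: (@le_trans _ _ (\int[lebesgue_measure]_u
      ((cst ((r - r0)^-1)%:E : R -> \bar R) \_ `]s, t[) u)%E).
    rewrite -integral_mkcond integral_cst//= lebesgue_measure_itv /= lte_fin.
    move: st; rewrite le_eqVlt => /predU1P[->|->]; last by rewrite -EFinD EFinM.
    by rewrite subrr mulr0 ltxx mule0.
  apply: ge0_le_integral_pointwise => u _.
    by rewrite patchE; case: ifP; rewrite /= ?lee_fin.
  rewrite !patchE; case: ifPn => [/set_mem /=|_]; last first.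
    by case: ifP => // _; exact: g0.
  rewrite in_itv /= => /andP[su ut]; rewrite mem_set; last first.
    by rewrite /= in_itv /= (ltW (le_lt_trans s0 su)) (ltW (lt_le_trans ut tl)).
  by rewrite /shell_gradient Hst.
have fl s t : a <= s -> s <= t -> t <= b -> `|mdist x (c t) - mdist x (c s)| <= t - s.
  move=> as_ st tb.
  have := curve_lipschitz (le_trans a0 as_) st (le_trans tb bl).
  have := metric_triangle x (c t) (c s); have := metric_triangle x (c s) (c t).
  by rewrite (metric_sym (c t) (c s)) ler_norml => *; apply/andP; split; lra.
have int0 : (0 <= curve_integral shell_gradient c)%E.
  by apply: integral_ge0 => *; exact: g0.
split.
  have [lt_pl|le_pl] := ltP (plateau r0 r (mdist x (c b)))
    (plateau r0 r (mdist x (c a))); last first.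
    by apply: le_trans int0; rewrite lee_fin subr_le0.
  have [s [t [as_ st tb Hk Hst]]] := plateau_crossing r0r fl ab lt_pl.
  apply: (@le_trans _ _ ((r - r0)^-1 * (t - s))%:E); first by rewrite lee_fin.
  by apply: H => //; [exact: le_trans as_|exact: le_trans bl].
have [lt_pl|le_pl] := ltP (plateau r0 r (mdist x (c a)))
  (plateau r0 r (mdist x (c b))); last first.
  by apply: le_trans int0; rewrite lee_fin subr_le0.
(* Reversing time on [[a, b]] turns a rise of the plateau into a fall. *)
pose f u := mdist x (c (a + b - u)).
have fl' s t : a <= s -> s <= t -> t <= b -> `|f t - f s| <= t - s.
  move=> as_ st tb; rewrite distrC /f.
  by have := fl (a + b - t) (a + b - s); rewrite (_ : a + b - s - _ = t - s); [apply; lra|lra].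
have fab : f a = mdist x (c b) /\ f b = mdist x (c a).
  by rewrite /f (_ : a + b - a = b) 1?(_ : a + b - b = a)//; lra.
rewrite -fab.1 -fab.2 in lt_pl *.
have [s [t [as_ st tb Hk Hst]]] := plateau_crossing r0r fl' ab lt_pl.
apply: (@le_trans _ _ ((r - r0)^-1 * (t - s))%:E); first by rewrite lee_fin.
have -> : t - s = (a + b - s) - (a + b - t) by lra.
apply: H; [lra|lra|lra|] => u su ut.
have := Hst (a + b - u); rewrite /f (_ : a + b - (a + b - u) = u); last by lra.
by apply; lra.
Qed.

(* Along a curve inside the ball the cutoff is the plateau function or is zero
   throughout; a curve leaving the ball crosses as much of the shell as the
   value of the cutoff requires. *)
Lemma shell_upper_gradient :
  upper_gradient (fun y : borel X => (cutoff y)%:E) shell_gradient.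
Proof.
split; first exact: shell_gradient_nonneg_borel.
move=> c; rewrite /upper_gradient_on /=; set l := curve_len c.
have l0 : 0 <= l by exact/ltW/curve_len_gt0.
have int0 : (0 <= curve_integral shell_gradient c)%E.
  by apply: integral_ge0 => *; exact: shell_gradient_nonneg_borel.2.
(* The absolute value splits into one-sided bounds for the two orders of the endpoints. *)
suff H a b : (a = 0 /\ b = l) \/ (a = l /\ b = 0) ->
    ((cutoff (c a) - cutoff (c b))%:E <= curve_integral shell_gradient c)%E.
  rewrite /=; have [le0|gt0] := leP (cutoff (c 0) - cutoff (c l)) 0.
    by rewrite ler0_norm// opprB; apply: H; right.
  by rewrite gtr0_norm//; apply: H; left.
move=> abE; rewrite /cutoff; case: asboolP => [Ua|nUa]; last first.
  by apply: le_trans int0; case: ifP => _; rewrite lee_fin ?subrr// sub0r oppr_le0 plateau_ge0.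
have [inB|/existsNP[t /not_implyP[t0l /negP]]] :=
  pselect (forall t, 0 <= t <= l -> mdist x (c t) < r).
  have Bc t : 0 <= t <= l -> B (c t) by move=> /inB; rewrite BE.
  have Ub : U (c b).
    suff : chainable B e (c a) (c b).
      by move=> ch V Vx VV; apply: ch (VV); exact: Ua.
    case: abE => -[-> ->].
      exact: lipschitz_path_chainable (@curve_lipschitz _ _ c) l0 e0 Bc.
    have := lipschitz_path_chainable (lipschitz_path_rev (@curve_lipschitz _ _ c)) l0 e0.
    rewrite add0r subr0 subrr; rewrite -/l; apply => t tl; apply: Bc; move: tl; lra.
  rewrite asboolT//.
  have [h1 h2] := @shell_integral c 0 l (lexx _) (lexx _) l0.
  by case: abE => -[-> ->].
rewrite -leNgt => rt; move: t0l => /andP[t0 tl].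
have cb0 : 0 <= (if `[< U (c b) >] then plateau r0 r (mdist x (c b)) else 0).
  by case: ifP => // _; exact: plateau_ge0.
apply: (@le_trans _ _ (plateau r0 r (mdist x (c a)) - plateau r0 r (mdist x (c t)))%:E).
  by rewrite lee_fin (plateau0 r0r rt) subr0 gerBl.
case: abE => -[-> _].
  exact: (@shell_integral c 0 t (lexx _) tl t0).1.
exact: (@shell_integral c t l t0 (lexx _) tl).2.
Qed.

Lemma energy_bounded_on_ball (g : borel X -> \bar R) (k : R) :
  (forall y, mdist x y < r -> (0 <= g y <= k%:E)%E) ->
  (forall y, r <= mdist x y -> g y = 0%E) -> (energy p mu g < +oo)%E.
Proof.
move=> gk g0; have p0 : 0 < p by exact: lt_le_trans p1.
have kk y : mdist x y < r -> 0 <= k.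
  by move=> /gk /andP[h1 h2]; rewrite -lee_fin; exact: le_trans h2.
apply: (@le_lt_trans _ _ (\int[mu]_(y in (ball x r : set (borel X))) cst (k `^ p)%:E y)%E).
  rewrite [leRHS]integral_mkcond; apply: ge0_le_integral_pointwise => y _.
    exact: poweR_ge0.
  rewrite patchE; case: ifPn => [/set_mem|/negP]; rewrite ?inE ballEmdist /= => yr.
    have /andP[gy0 gyk] := gk y yr.
    rewrite -poweR_EFin; apply: gt0_ler_poweR => //; first exact: ltW.
      by rewrite in_itv /= gy0 leey.
    by rewrite in_itv /= lee_fin leey (kk y).
  by rewrite g0 ?poweR0r ?gt_eqF// leNgt; apply/negP.
rewrite integral_cst; last exact: measurable_ball_borel.
have /andP[_ Moo] := mu_ball x (lt_trans r00 r0r).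
by rewrite lte_mul_pinfty// lee_fin powR_ge0.
Qed.

Lemma shell_gradient_energy : (energy p mu shell_gradient < +oo)%E.
Proof.
apply: (@energy_bounded_on_ball _ (r - r0)^-1) => y yr.
  by rewrite /shell_gradient; case: ifP => _; rewrite !lee_fin ?lexx k0.
by rewrite /shell_gradient ltNge yr andbF.
Qed.

Lemma cutoff_newtonian : newtonian p mu (fun y : borel X => (cutoff y)%:E).
Proof.
split; first exact: measurable_cutoff.
apply: lte_add_pinfty.
  apply: (@energy_bounded_on_ball _ 1) => y yr.
    rewrite /= !lee_fin normr_ge0 ger0_norm//= /cutoff; case: ifP => _ //.
    exact: plateau_le1.
  rewrite /cutoff asboolF ?abse0//= => /UB; rewrite BE; lra.
apply: le_lt_trans shell_gradient_energy; apply: ereal_inf_lbound.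
by exists shell_gradient => //; exact: shell_upper_gradient.
Qed.

(** By minimality the gradient is almost everywhere at most [shell_gradient], which vanishes within
    [r0] of [x]. In the other case of [xget] the default value is zero as well. *)
Lemma minimal_gradient_cutoff0 :
  {ae mu, forall y : borel X, ball x r0 y ->
    minimal_weak_upper_gradient p mu (fun y : borel X => (cutoff y)%:E) y = 0%E}.
Proof.
rewrite /minimal_weak_upper_gradient; case: xgetP => [g _ [[[mg g0] _] _ gmin]|_]; last first.
  exact: aeW.
have := gmin shell_gradient; case.
- split; first exact: shell_gradient_nonneg_borel.
  (* An upper gradient is a weak one with empty exceptional family, witnessed by [rho] equal to
     zero. *)
  exists set0; last by move=> c _; exact: shell_upper_gradient.2.
  exists (cst 0%E); split; [by split; [exact: measurable_cst|]| |by []].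
  rewrite /energy (eq_integral (cst 0%E)); first by rewrite integral0.
  move=> y _.
  by rewrite poweR0r// gt_eqF//; exact: lt_le_trans p1.
- exact: shell_gradient_energy.
move=> N [mN N0 NP]; exists N; split=> //; apply: subset_trans NP => y /= ngy gy; apply: ngy.
rewrite ballEmdist /= => yr; apply/eqP; rewrite eq_le g0 andbT.
by move: gy; rewrite /shell_gradient (leNgt r0) yr.
Qed.

End cutoff.

(** * The Poincaré inequality applied to the cutoff *)

Section local_connectedness.
Context {R : realType} {X : completeMetricType R}.
Variables (p : R) (mu : {measure set (borel X) -> \bar R}).
Hypothesis mu_ball : finite_positive_on_balls mu.

Lemma ae_meets_balls (P : borel X -> Prop) (y : X) (d : R) :
  {ae mu, forall z, P z} -> 0 < d -> exists2 z, mdist y z < d & P z.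
Proof.
move=> [N [mN N0 NP]] d0; apply: contrapT => /forall2NP H.
have /andP[+ _] := mu_ball y d0.
suff -> : mu (ball y d) = 0%E by rewrite ltxx.
apply/eqP; rewrite eq_le measure_ge0 andbT -N0.
apply: le_measure; rewrite ?inE//; first exact: measurable_ball_borel.
move=> z; rewrite ballEmdist /= => yz; apply: NP => /= Pz.
by have [|] := H z.
Qed.

Hypothesis p1 : 1 <= p.

Lemma measurable_minimal_weak_upper_gradient u :
  measurable_fun setT (minimal_weak_upper_gradient p mu u).
Proof.
by rewrite /minimal_weak_upper_gradient; case: xgetP => [g _ [[[mg _] _] _ _]|_].
Qed.

Hypothesis mu_poincare : poincare p mu.

(* The cutoff function of the chainable component has vanishing upper gradient
   on the inner ball, so it is almost everywhere constant there. *)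
Lemma poincare_chainable : exists2 l : R, 1 <= l & forall (x : X) s e y,
  0 < s -> 0 < e -> mdist x y < s -> chainable (ball x (2 * l * s)) e x y.
Proof.
have [C [l [C0 l1 CP]]] := mu_poincare; exists l => // x s e y s0 e0 xy.
apply: contrapT => nUy.
have l0 : 0 < l by exact: lt_le_trans l1.
(* The inner radius [l * s] is that of the dilated ball in the inequality, so the right side
   vanishes. *)
have r00 : 0 < l * s by rewrite mulr_gt0.
have sr0 : s <= l * s by rewrite ler_peMl// ltW.
have r0r : l * s < 2 * l * s by rewrite -mulrA ltr_pMl// ltr1n.
pose u (z : borel X) := (cutoff x (l * s) (2 * l * s) e z)%:E.
have p0 : p != 0 by rewrite gt_eqF// (lt_le_trans _ p1).
set m := mean mu (ball x s) u.
have grad0 : (\int[mu]_(z in ball x (l * s)) (minimal_weak_upper_gradient p mu u z `^ p))%E = 0%E.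
  rewrite (ae_eq_integral (cst 0%E)) ?integral0//.
  - exact: measurable_ball_borel.
  - apply: measurable_funTS.
    apply: (measurableT_comp (measurable_poweR p)).
    exact: measurable_minimal_weak_upper_gradient.
  - have := minimal_gradient_cutoff0 mu_ball p1 x r00 r0r e0.
    apply: filterS => z H xz; rewrite H// poweR0r//.
have := CP x s u s0 (cutoff_newtonian mu_ball p1 x r00 r0r e0).
rewrite /mean grad0 mule0 poweR0r ?invr_eq0// mule0 -/(mean mu (ball x s) u) -/m.
have /andP[M0 Moo] := mu_ball x s0.
have M'0 : (0 < (fine (mu (ball x s)))^-1)%R by rewrite invr_gt0 fine_gt0// M0.
rewrite pmule_rle0 ?lte_fin// => int_le0.
have mum : measurable_fun (ball x s : set (borel X)) (fun z => (u z - m)%E).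
  apply: emeasurable_funB; last exact: measurable_cst.
  by apply: measurable_funTS; exact: measurable_cutoff.
have : ae_eq mu (ball x s) (fun z => (u z - m)%E) (cst 0%E).
  apply/ae_eq_integral_abs => //; first exact: measurable_ball_borel.
  by apply/eqP; rewrite eq_le int_le0 integral_ge0.
move=> uae.
have [d0 dP] : 0 < Num.min s e /\ forall t : R, t < Num.min s e -> t < s /\ t < e.
  by rewrite lt_min s0 e0; split => // t; rewrite lt_min => /andP.
(* A point [z1] within [e] of [x] is chainable, so the cutoff is 1 there and the mean [m] is 1. *)
have [z1 /dP[z1s z1e] /=] := ae_meets_balls x uae d0.
rewrite ballEmdist /= => /(_ z1s); rewrite /u /cutoff asboolT; last first.
  apply: chainable_step z1e; first exact: chainable_refl.
  by rewrite ballEmdist /=; apply: lt_trans (le_lt_trans sr0 r0r).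
rewrite plateau1//; last by exact: ltW (lt_le_trans z1s sr0).
move=> m1.
have [d0' dP'] : 0 < Num.min (s - mdist x y) e /\
    forall t : R, t < Num.min (s - mdist x y) e -> t < s - mdist x y /\ t < e.
  by rewrite lt_min subr_gt0 xy e0; split => // t; rewrite lt_min => /andP.
(* If [z2], which is within [e] of [y], were chainable, so would be [y]; hence the cutoff is 0 at
   [z2] and [m] is 0. *)
have [z2 /dP'[z2s z2e] /=] := ae_meets_balls y uae d0'.
have xz2 : mdist x z2 < s by have := metric_triangle x y z2; lra.
rewrite ballEmdist /= => /(_ xz2); rewrite /u /cutoff asboolF; last first.
  move=> Uz2; apply: nUy; apply: chainable_step Uz2 _ _; last by rewrite metric_sym.
  by rewrite ballEmdist /=; apply: lt_trans xy (le_lt_trans sr0 r0r).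
move=> /eqP; rewrite sub0e oppe_eq0 => /eqP m0.
by move: m1 => /eqP; rewrite m0 sube0 onee_eq0.
Qed.

Hypothesis mu_doubling : doubling mu.

Lemma locally_connected (x : X) (r : R) : 0 < r ->
  exists2 s, 0 < s & forall y, mdist x y < s ->
    exists C, [/\ connected C, C `<=` ball x r, C x & C y].
Proof.
move=> r0; have [l l1 lP] := poincare_chainable.
have l0 : 0 < l by exact: lt_le_trans l1.
(* With this [s], [2 * l * s = r / 2], so the chains stay in the compact closed ball of radius
   [r / 2], which lies in [ball x r]. *)
exists (r / (4 * l)) => [|y xy]; first by rewrite divr_gt0// mulr_gt0.
have sE : 2 * l * (r / (4 * l)) = r / 2 by field; rewrite gt_eqF.
have ballK : ball x (r / 2) `<=` [set z | mdist x z <= r / 2].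
  by move=> z; rewrite ballEmdist => /ltW.
have [| |D [cD DK Dx Dy]] := @chainable_connected _ X _ x y
    (@mdist_closed_ball_compact _ _ _ mu_ball mu_doubling x (r / 2)).
- by rewrite /= mdistxx divr_ge0// ltW.
- move=> e e0; apply: chainableW ballK (lexx _) _; rewrite -sE; apply: lP => //.
  by rewrite divr_gt0// mulr_gt0.
- exists D; split=> // z /DK /=; rewrite ballEmdist /=; lra.
Qed.

End local_connectedness.
(** * Chains and ends *)

(** Off the boundary of [A] its interior and closure agree, so a set [G] avoiding it would meet [A]
    in a relatively clopen part, which by connectedness is all of [G]. *)
Lemma connected_meets_boundary (R : realType) (X : metricType R) (G A : set X) :
  connected G -> G `&` A !=set0 -> ~ (G `<=` A) -> G `&` boundary A !=set0.
Proof.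
move=> cG GA; apply: contra_notP => /set0P/negP/negPn/eqP Gb0.
have GiA : G `&` A = G `&` interior A.
  apply/seteqP; split=> y [Gy Ay]; split=> //; last exact: interior_subset.
  apply: contrapT => iy; have : (G `&` boundary A) y.
    by split=> //; split=> //; exact: subset_closure.
  by rewrite Gb0.
have GcA : G `&` A = G `&` closure A.
  apply/seteqP; split=> y [Gy Ay]; split=> //; first exact: subset_closure.
  apply: contrapT => nAy; have : (G `&` boundary A) y.
    by split=> //; split=> // /interior_subset.
  by rewrite Gb0.
have <- : G `&` A = G by apply: cG => //; [exists (interior A) => //; exact: open_interior|
  exists (closure A) => //; exact: closed_closure].
exact: subIsetr.
Qed.

Section ends_theory.
Context {R : realType} {X : metricType R}.
Variable Omega : set X.
Implicit Types E F : nat -> set X.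

Lemma diam_lt (G : set X) (d : R) u v :
  (diam G < d%:E)%E -> G u -> G v -> mdist u v < d.
Proof.
move=> Gd Gu Gv; rewrite -lte_fin; apply: le_lt_trans Gd.
by apply: ereal_sup_ubound; exists (u, v).
Qed.

Lemma diam_le (G : set X) (d : R) :
  (forall u v, G u -> G v -> mdist u v <= d) -> (diam G <= d%:E)%E.
Proof. by move=> Gd; apply: ge_ereal_sup => _ [[u v] [Gu Gv] <-]; rewrite lee_fin Gd. Qed.

Lemma chain_le E k l : chain Omega E -> (k <= l)%N -> E l `<=` E k.
Proof.
move=> [_ E_decr _ _] /subnK <-; elim: (l - k)%N => [//|n IH].
by apply: subset_trans IH; rewrite addSn; exact: E_decr.
Qed.

Lemma chain_sub E k : chain Omega E -> E k `<=` Omega.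
Proof. by move=> [/(_ k) [_ _ /properW]]. Qed.

Lemma chain_nonempty E k : chain Omega E -> exists a : Omega, E k (\val a).
Proof.
move=> cE; have [/(_ k) [_ _ _ [b [Eb _]]] _ _ _] := cE.
have [a [Ea _]] := Eb setT (@filterT _ _ _).
by exists (exist _ a (mem_set (chain_sub cE Ea))).
Qed.

Lemma chain_separated E k : chain Omega E -> exists2 d : R, 0 < d &
  forall u v, Omega u -> boundary (E k.+1) u -> Omega v -> boundary (E k) v -> d <= mdist u v.
Proof.
move=> [_ _ /(_ k) + _]; set s := set_dist _ _ => s0.
have [d d0 ds] : exists2 d : R, 0 < d & (d%:E <= s)%E.
  case: s s0 => [s|_|//]; first by rewrite lte_fin => s0; exists s.
  by exists 1 => //; exact: leey.
exists d => // u v Ou bu Ov bv; rewrite -lee_fin; apply: (le_trans ds).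
by apply: ereal_inf_lbound; exists (u, v).
Qed.

(* A connected set reaching from [E k.+1] out of [E k] meets both relative
   boundaries, so it cannot be small. *)
Lemma chain_trap E k : chain Omega E -> exists2 d : R, 0 < d &
  forall G, connected G -> G `<=` Omega -> (diam G < d%:E)%E ->
    G `&` E k.+1 !=set0 -> G `<=` E k.
Proof.
move=> cE; have [d d0 dP] := chain_separated k cE; exists d => // G cG GO Gd GE.
apply: contrapT => nGE.
have [|u [Gu bu]] := connected_meets_boundary cG GE.
  by move=> /subset_trans/(_ (chain_le cE (leqnSn k))).
have [|//|v [Gv bv]] := @connected_meets_boundary _ _ _ (E k) cG.
  by move: GE => [y [Gy Ey]]; exists y; split=> //; exact: chain_le Ey.
have := dP u v (GO _ Gu) bu (GO _ Gv) bv.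
by rewrite leNgt (diam_lt Gd).
Qed.

(** A point of [E k.+1] not interior to [E k] would be a boundary point of both sets, contradicting
    their positive distance. *)
Lemma chain_interior E k : chain Omega E -> E k.+1 `<=` interior (E k).
Proof.
move=> cE x Ex; apply: contrapT => nx.
have [d d0 dP] := chain_separated k cE.
have EE := chain_le cE (leqnSn k).
suff : d <= mdist x x by rewrite mdistxx leNgt d0.
apply: dP; try exact: chain_sub cE _ Ex.
- by split; [exact: subset_closure|move=> /(interiorS EE)].
- by split=> //; apply: subset_closure; exact: EE.
Qed.

Lemma ends_chain (e : ends Omega) : exists2 E, chain Omega E & \val e E.
Proof.
case: e => e /= /[dup] /set_mem [E cE <-] _; exists E => //; split=> //.
by split=> k; exists k.
Qed.

(** Division is transitive, so every chain of the class can serve as its representative. *)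
Lemma ends_memP (e : ends Omega) E F : \val e E ->
  \val e F <-> chain Omega F /\ chain_equiv E F.
Proof.
case: e => e /= /[dup] /set_mem [D cD <-] _ [cE [DE ED]].
have trans (E1 E2 E3 : nat -> set X) : divides E1 E2 -> divides E2 E3 -> divides E1 E3.
  move=> E12 E23 k; have [l El] := E23 k; have [m Em] := E12 l; exists m.
  exact: subset_trans El.
split=> -[cF [F1 F2]]; split=> //; split.
- exact: trans ED F1.
- exact: trans F2 DE.
- exact: trans DE F1.
- exact: trans F2 ED.
Qed.

Lemma ends_eq (e e' : ends Omega) E E' : \val e E -> \val e' E' ->
  chain_equiv E E' -> e = e'.
Proof.
move=> eE e'E' EE'; apply: val_inj.
have cE' : chain Omega E' by have [c _] := (ends_memP E' e'E').1 e'E'.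
have eE' : \val e E' by apply/(ends_memP E' eE).
by apply/seteqP; split=> F => [/(ends_memP F eE')/(ends_memP F e'E')|
  /(ends_memP F e'E')/(ends_memP F eE')].
Qed.

Lemma end_of_chain E : chain Omega E -> exists e : ends Omega, \val e E.
Proof.
move=> cE.
have eP : [set F | chain Omega F /\ chain_equiv E F] \in @ends _ _ Omega.
  by apply: mem_set; exists E.
by exists (exist (fun f => f \in ends Omega) _ eP); split=> //; split=> k; exists k.
Qed.

Lemma impressionS E F : divides E F -> impression E `<=` impression F.
Proof.
move=> EF x Ex k _; have [l El] := EF k.
by apply: closureS El _ _; exact: Ex.
Qed.

(** For open [G] these sets are open; around an end, [G] will be the interior of a set of one of its
    chains. *)
Definition end_space_ball (G : set X) : set (end_space Omega) :=
  [set y | match y with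
           | inl a => G (\val a)
           | inr e => forall E, \val e E -> exists l, E l `<=` G
           end].

Lemma end_space_ball_open (G : set X) : open G -> open (end_space_ball G).
Proof.
move=> oG; rewrite -(setCK (end_space_ball G)) openC; apply/end_space_closedP.
move=> s y sG; case: y => [a|e] /=.
  move=> [u su ua] Ga.
  have [N _ NP] : (\forall n \near \oo, G (\val (u n))).
    by apply: ua; exact: open_nbhs_nbhs.
  by apply: (sG N); rewrite su /=; exact: NP (leqnn N).
have [E cE eE] := ends_chain e.
move=> lims /(_ E eE) [l El].
case: lims => -[u su ue].
  have [N NP] := ue E eE l; apply: (sG N).
  by rewrite su /=; apply: El; exact: NP (leqnn N).
have [N NP] := ue E eE l; apply: (sG N).
rewrite su /= => F uF; have [m Fm] := NP N (leqnn N) F uF; exists m.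
exact: subset_trans El.
Qed.

End ends_theory.
(** * The Mazurkiewicz completion *)

Section mazurkiewicz.
Context {R : realType} {X Y : completeMetricType R}.
Variables (Omega : set X) (iota : Omega -> Y).
Hypothesis iotaP : mazurkiewicz_completion iota.
Hypothesis open_Omega : open Omega.
Hypothesis local_conn : forall (x : X) (r : R), 0 < r ->
  exists2 s, 0 < s & forall y, mdist x y < s ->
    exists C, [/\ connected C, C `<=` ball x r, C x & C y].
Implicit Types (E F : nat -> set X) (a b : Omega) (z : Y).

Lemma iota_dist_connected a b (d : R) : mdist (iota a) (iota b) < d ->
  exists G, [/\ connected G, G `<=` Omega, G (\val a), G (\val b) & (diam G < d%:E)%E].
Proof.
rewrite -lte_fin iotaP.1 => /ereal_inf_lt[_ [G [cG GO Ga Gb] <-] Gd].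
by exists G.
Qed.

Lemma iota_dist_le a b G (d : R) : connected G -> G `<=` Omega -> G (\val a) -> G (\val b) ->
  (forall u v, G u -> G v -> mdist u v <= d) -> mdist (iota a) (iota b) <= d.
Proof.
move=> cG GO Ga Gb Gd; rewrite -lee_fin iotaP.1; apply: le_trans (diam_le Gd).
by apply: ereal_inf_lbound; exists G.
Qed.

Lemma iota_expands a b : mdist (\val a) (\val b) <= mdist (iota a) (iota b).
Proof.
apply/ler_addgt0Pr => e e0.
have [|G [_ _ Ga Gb Gd]] := @iota_dist_connected a b (mdist (iota a) (iota b) + e).
  by rewrite ltrDl.
exact/ltW/(diam_lt Gd).
Qed.

Lemma iota_dense z (d : R) : 0 < d -> exists a, mdist z (iota a) < d.
Proof.
move=> d0.
have [y [/= zy [a _ ay]]] : ball z d `&` range iota !=set0.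
  apply: iotaP.2; last exact: mdist_ball_open.
  by exists z; exact: ballxx.
by exists a; rewrite ay; move: zy; rewrite ballEmdist.
Qed.

(** Local connectedness joins [a] to each nearby point inside a small ball contained in [Omega],
    which bounds the Mazurkiewicz distance. *)
Lemma iota_continuous a (e : R) : 0 < e ->
  exists2 s, 0 < s & forall b, mdist (\val a) (\val b) < s -> mdist (iota a) (iota b) < e.
Proof.
move=> e0; have [r r0 rO] := (open_mdistP Omega).1 open_Omega _ (set_valP a).
have [|s s0 sP] := @local_conn (\val a) (Num.min r (e / 3)).
  by rewrite lt_min r0 divr_gt0.
exists s => // b /sP[C [cC Cr Ca Cb]].
have Cd u : C u -> mdist (\val a) u < r /\ mdist (\val a) u < e / 3.
  by move=> /Cr; rewrite ballEmdist /= lt_min => /andP.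
apply: (@le_lt_trans _ _ (e / 3 + e / 3)); last by lra.
apply: iota_dist_le cC _ Ca Cb _; first by move=> u /Cd[ur _]; exact: rO.
move=> u v /Cd[_ ue] /Cd[_ ve].
by have := metric_triangle u (\val a) v; rewrite (metric_sym u (\val a)); lra.
Qed.

(** The identity of [Omega] is 1-Lipschitz from the Mazurkiewicz metric to that of [X], hence
    extends to the completion; [x] is the image of [z]. *)
Lemma completion_trace z : exists x : X, forall a, mdist x (\val a) <= mdist z (iota a).
Proof.
have [a aP] := choice (fun n : nat => @iota_dense z n.+1%:R^-1 ltac:(by rewrite invr_gt0)).
have zd n b : mdist (\val (a n)) (\val b) <= n.+1%:R^-1 + mdist z (iota b).
  apply: (le_trans (iota_expands _ _)).
  have := metric_triangle (iota (a n)) z (iota b); rewrite (metric_sym (iota (a n)) z).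
  have := aP n; move: (n.+1%:R^-1 : R) => q; lra.
have [|x xP] := @cauchy_seq_cvg _ _ (fun n => \val (a n)).
  move=> e e0; have e20 : 0 < e / 2 by rewrite divr_gt0.
  have [N NP] := invSn_lt e20; exists N => n m Nn Nm.
  have := zd n (a m); have := aP m; have := NP n Nn; have := NP m Nm.
  by move: (n.+1%:R^-1 : R) (m.+1%:R^-1 : R) => q q'; lra.
exists x => b; apply/ler_addgt0Pr => e e0.
have e20 : 0 < e / 2 by rewrite divr_gt0.
have [N NP] := invSn_lt e20; have [M MP] := xP _ e20.
have := zd (maxn N M) b; have := NP _ (leq_maxl N M); have := MP _ (leq_maxr N M).
have := metric_triangle x (\val (a (maxn N M))) (\val b).
by move: ((maxn N M).+1%:R^-1 : R) => q; lra.
Qed.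

Definition chain_cvg E z := forall e : R, 0 < e ->
  exists k, forall a, E k (\val a) -> mdist z (iota a) < e.

Lemma chain_cvg_unique E z z' : chain Omega E -> chain_cvg E z -> chain_cvg E z' -> z = z'.
Proof.
move=> cE Ez Ez'; apply: mdist_positivity; apply/eqP; rewrite eq_le mdist_ge0 andbT.
apply/ler_addgt0Pr => e e0; rewrite add0r.
have e20 : 0 < e / 2 by rewrite divr_gt0.
have [k kP] := Ez _ e20; have [l lP] := Ez' _ e20.
have [a Ea] := chain_nonempty (maxn k l) cE.
have := kP a (chain_le cE (leq_maxl k l) Ea); have := lP a (chain_le cE (leq_maxr k l) Ea).
by have := metric_triangle z (iota a) z'; rewrite (metric_sym (iota a) z'); lra.
Qed.

Lemma chain_cvg_divides E F z : divides F E -> chain_cvg E z -> chain_cvg F z.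
Proof.
move=> FE Ez e /Ez[k kP]; have [l Fl] := FE k.
by exists l => a Fa; apply: kP; exact: Fl.
Qed.

(** A point near [z] is joined to a point of [E k.+1] by a connected set too small to leave [E k],
    by [chain_trap]. *)
Lemma chain_cvg_neighborhood E z k : chain Omega E -> chain_cvg E z ->
  exists2 e : R, 0 < e & forall a, mdist z (iota a) < e -> E k (\val a).
Proof.
move=> cE Ez; have [d d0 dP] := chain_trap k cE.
have d20 : 0 < d / 2 by rewrite divr_gt0.
exists (d / 2) => // a za; have [j jP] := Ez _ d20.
have [b Eb] := chain_nonempty (maxn j k.+1) cE.
have zb := jP b (chain_le cE (leq_maxl _ _) Eb).
have [|G [cG GO Ga Gb Gd]] := @iota_dist_connected a b d.
  by have := metric_triangle (iota a) z (iota b); rewrite (metric_sym (iota a) z); lra.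
apply: (dP G cG GO Gd) Ga; exists (\val b); split=> //.
exact: (chain_le cE (leq_maxr j k.+1) Eb).
Qed.

(** Each set of one chain contains all points of [Omega] near [z], hence the late sets of the
    other. *)
Lemma chain_cvg_equiv E F z : chain Omega E -> chain Omega F ->
  chain_cvg E z -> chain_cvg F z -> chain_equiv E F.
Proof.
suff H E' F' : chain Omega E' -> chain Omega F' -> chain_cvg E' z -> chain_cvg F' z ->
  divides E' F' by move=> *; split; exact: H.
move=> cE cF Ez Fz k; have [e e0 eP] := chain_cvg_neighborhood k cF Fz.
have [l lP] := Ez e e0; exists l => x Ex.
pose a : Omega := exist _ x (mem_set (chain_sub cE Ex)).
by apply: (eP a); exact: (lP a).
Qed.

Hypothesis closed_ball_cpt : forall (x : X) (r : R), compact [set y : X | mdist x y <= r].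

(** Otherwise points of the sets [E k] staying [e] away from [x] would accumulate, by compactness,
    at a second point of the impression. *)
Lemma impression_point_small E x : chain Omega E -> impression E = [set x] ->
  forall e : R, 0 < e -> exists k, forall y, E k y -> mdist x y < e.
Proof.
move=> cE Ex e e0; apply: contrapT => /forallNP H.
have far k : exists y, E k y /\ e <= mdist x y.
  by have /existsNP[y /not_implyP[Ey /negP]] := H k; rewrite -leNgt => xy; exists y.
have [y yP] := choice far.
have [x0 [r Er]] : metric_bounded (E 0) by case: cE => /(_ 0%N) [].
have [|w _ wP] := @compact_seq_cluster _ _ _ y (@closed_ball_cpt x0 r).
  move=> n; have := Er _ (chain_le cE (leq0n n) (yP n).1).
  by rewrite ballEmdist => /ltW.
have : impression E w.
  move=> k _; apply/closure_mdistP => d d0; have [n kn wn] := wP d k d0.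
  by exists (y n) => //; exact: (chain_le cE kn (yP n).1).
rewrite Ex /= => xw; have [n _] := wP e 0%N e0.
by rewrite xw ltNge (yP n).2.
Qed.

(** The sets [E k] are connected and shrink to [x], so their Mazurkiewicz diameters tend to zero and
    any choice of points in them is Cauchy. *)
Lemma chain_cvg_exists E x : chain Omega E -> impression E = [set x] ->
  exists z, chain_cvg E z.
Proof.
move=> cE Ex.
have small (e : R) : 0 < e -> exists k, forall a b, E k (\val a) -> E k (\val b) ->
    mdist (iota a) (iota b) < e.
  move=> e0; have e30 : 0 < e / 3 by rewrite divr_gt0.
  have [k kP] := impression_point_small cE Ex e30; exists k => a b Ea Eb.
  apply: (@le_lt_trans _ _ (e / 3 + e / 3)); last by lra.
  apply: (iota_dist_le _ (chain_sub (k := k) cE) Ea Eb).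
    by case: cE => /(_ k) [].
  move=> u v /kP xu /kP xv.
  by have := metric_triangle u x v; rewrite (metric_sym u x); lra.
have [a aP] := choice (fun k => chain_nonempty k cE).
have [|z zP] := @cauchy_seq_cvg _ _ (fun n => iota (a n)).
  move=> e e0; have [k kP] := small e e0; exists k => n m kn km.
  by apply: kP; [exact: (chain_le cE kn (aP n))|exact: (chain_le cE km (aP m))].
exists z => e e0; have e20 : 0 < e / 2 by rewrite divr_gt0.
have [k kP] := small _ e20; have [N NP] := zP _ e20; exists k => b Eb.
have := kP (a (maxn k N)) b (chain_le cE (leq_maxl _ _) (aP _)) Eb.
have := NP _ (leq_maxr k N); have := metric_triangle z (iota (a (maxn k N))) (iota b).
lra.
Qed.

(** A limit [iota a] would put [a] in the impression, hence on the boundary of the open set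
    [Omega]. *)
Lemma chain_cvg_notin_range E z x : chain Omega E -> impression E = [set x] ->
  chain_cvg E z -> (~` range iota) z.
Proof.
move=> cE Ex Ez [a _ az].
have : impression E (\val a).
  move=> k _; apply/closure_mdistP => e e0; have [l lP] := Ez e e0.
  have [b Eb] := chain_nonempty (maxn k l) cE.
  exists (\val b); first exact: (chain_le cE (leq_maxl _ _) Eb).
  apply: le_lt_trans (iota_expands _ _) _; rewrite az; apply: lP.
  exact: (chain_le cE (leq_maxr _ _) Eb).
case: cE => _ _ _ /[apply] -[_]; apply; rewrite ((interior_id _).1 open_Omega).
exact: set_valP.
Qed.

End mazurkiewicz.

(** * A chain converging to a given boundary point of the completion *)

Section chain_at_boundary_point.
Context {R : realType} {X Y : completeMetricType R}.
Variables (Omega : set X) (iota : Omega -> Y).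
Hypothesis iotaP : mazurkiewicz_completion iota.
Hypothesis Omega_dom : bounded_domain Omega.
Hypothesis local_conn : forall (x : X) (r : R), 0 < r ->
  exists2 s, 0 < s & forall y, mdist x y < s ->
    exists C, [/\ connected C, C `<=` ball x r, C x & C y].
Variables (z : Y) (x : X).
Hypothesis xz : forall a, mdist x (\val a) <= mdist z (iota a).
Hypothesis zNOmega : (~` range iota) z.

Let open_Omega : open Omega. Proof. by case: Omega_dom. Qed.

(** Were [x] in [Omega], points of [Omega] tending to [z] would tend to [x] in [X], hence to its
    image under [iota] by [iota_continuous], and [z] would be that image. *)
Let xNOmega : ~ Omega x.
Proof.
move=> Ox; pose a : Omega := exist _ x (mem_set Ox).
apply: zNOmega; exists a => //; apply/esym/mdist_positivity/eqP.
rewrite eq_le mdist_ge0 andbT; apply/ler_addgt0Pr => e e0; rewrite add0r.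
have e20 : 0 < e / 2 by rewrite divr_gt0.
have [s s0 sP] := iota_continuous iotaP open_Omega local_conn a e20.
have [|b] := @iota_dense _ _ _ _ _ iotaP z (Num.min s (e / 2)).
  by rewrite lt_min s0.
rewrite lt_min => /andP[zs ze].
have /sP ab : mdist (\val a) (\val b) < s by exact: le_lt_trans (xz b) zs.
have := metric_triangle z (iota b) (iota a).
by rewrite (metric_sym (iota b)); lra.
Qed.

(* A single component: all points close to [z] lie in the same one. *)
Definition access (r : R) : set X :=
  [set w | exists2 a, mdist z (iota a) < r / 4 &
    connected_component (Omega `&` ball x r) (\val a) w].

Let access_sub r : access r `<=` Omega `&` ball x r.
Proof. by move=> w [a _] /connected_component_sub. Qed.

(** Two points within [r / 4] of [z] lie in a connected set of diameter below [r / 2], which stays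
    within [r / 4 + r / 2] of [x]; hence they share a component. *)
Let accessE r a : mdist z (iota a) < r / 4 ->
  access r = connected_component (Omega `&` ball x r) (\val a).
Proof.
move=> za; have r0 : 0 < r by have := mdist_ge0 z (iota a); lra.
apply/seteqP; split=> w; last by exists a.
move=> [b zb bw]; apply: connected_component_trans bw.
have [|G [cG GO Ga Gb Gd]] := @iota_dist_connected _ _ _ _ _ iotaP a b (r / 2).
  by have := metric_triangle (iota a) z (iota b); rewrite (metric_sym (iota a) z); lra.
apply: (@connected_component_max _ _ G) => // u Gu; split; first exact: GO.
rewrite ballEmdist /=; have := diam_lt Gd Ga Gu; have := xz a.
by have := metric_triangle x (\val a) u; lra.
Qed.

Let access_near r : 0 < r -> exists2 a, mdist z (iota a) < r / 4 & access r (\val a).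
Proof.
move=> r0; have [|a za] := @iota_dense _ _ _ _ _ iotaP z (r / 4).
  by rewrite divr_gt0.
exists a => //; exists a => //; apply: connected_component_refl.
split; first exact: set_valP.
by rewrite ballEmdist /=; have := xz a; lra.
Qed.

Let access_connected r : 0 < r -> connected (access r).
Proof.
by move=> /access_near[a za _]; rewrite (accessE za); exact: component_connected.
Qed.

Let access_center r : 0 < r -> closure (access r) x.
Proof.
move=> r0; apply/closure_mdistP => d d0.
have [|a] := @iota_dense _ _ _ _ _ iotaP z (Num.min d (r / 4)).
  by rewrite lt_min d0 divr_gt0.
rewrite lt_min => /andP[zd zr]; exists (\val a); last exact: le_lt_trans (xz a) zd.
exists a => //; apply: connected_component_refl; split; first exact: set_valP.
by rewrite ballEmdist /=; have := xz a; lra.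
Qed.

Let access_closure r y : closure (access r) y -> mdist x y <= r.
Proof.
move=> /closure_mdistP cy; apply/ler_addgt0Pr => d d0; have [a aE ya] := cy d d0.
have [_] := access_sub aE; rewrite ballEmdist /= => xa.
by have := metric_triangle x a y; rewrite (metric_sym a y); lra.
Qed.

(* Local connectedness makes the components of the open set
   [Omega `&` ball x r] open, so [access r] has no boundary inside it. *)
Let access_boundary r y : Omega y -> boundary (access r) y -> r <= mdist x y.
Proof.
move=> Oy [cy niy]; rewrite leNgt; apply/negP => xy; apply: niy.
have oA : open (Omega `&` ball x r) by apply: openI => //; exact: mdist_ball_open.
have [|d d0 dA] := (open_mdistP _).1 oA y; first by split=> //; rewrite ballEmdist.
have [s s0 sP] := local_conn y d0.
have yC u : mdist y u < s -> connected_component (Omega `&` ball x r) y u.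
  move=> /sP[C [cC Cd Cy Cu]]; apply: (@connected_component_max _ _ C) => // v /Cd.
  by rewrite ballEmdist => /dA.
have [w [a za aw] yw] := (closure_mdistP _ _).1 cy s s0.
apply/nbhs_ballP; exists s => // u; rewrite ballEmdist /= => yu.
exists a => //; apply: connected_component_trans (yC u yu).
apply: connected_component_trans aw _; apply: connected_component_sym.
exact: yC.
Qed.

Let accessS r s : r <= s -> access r `<=` access s.
Proof.
move=> rs w [a za aw]; exists a; first lra.
have rsA : Omega `&` ball x r `<=` Omega `&` ball x s by apply: setIS; exact: le_ball.
apply: (@connected_component_max _ _ (connected_component (Omega `&` ball x r) (\val a))) => //.
- apply: connected_component_refl; split; first exact: set_valP.
  rewrite ballEmdist /=; have := mdist_ge0 z (iota a); have := xz a; lra.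
- exact: subset_trans (@connected_component_sub _ _ _) rsA.
- exact: component_connected.
Qed.

Lemma chain_at_boundary_point : exists2 E,
  chain Omega E /\ impression E = [set x] & chain_cvg iota E z.
Proof.
have [[x0 [r1 Or1]] [b Ob] _ _] := Omega_dom.
have xb : 0 < mdist x b by rewrite mdist_gt0; apply/eqP => xb; apply: xNOmega; rewrite xb.
(* The factor [mdist x b] keeps [b] out of every [ball x (rad n)], so each [access (rad n)] is a
   proper subset of [Omega]. *)
pose rad n := mdist x b * n.+1%:R^-1.
have rad0 n : 0 < rad n by rewrite mulr_gt0 ?invr_gt0.
have radS n : rad n.+1 < rad n by rewrite ltr_pM2l// ltf_pV2 ?posrE// ltr_nat.
have rad_small d : 0 < d -> exists n, rad n < d.
  move=> d0; have [|N NP] := @invSn_lt R (d / mdist x b); first by rewrite divr_gt0.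
  by exists N; rewrite /rad mulrC -ltr_pdivlMr//; exact: NP.
have xO : boundary Omega x.
  split; last by rewrite ((interior_id _).1 open_Omega).
  apply: closureS (access_center (rad0 0%N)).
  by move=> w /access_sub[].
have imp : impression (fun n => access (rad n)) = [set x].
  apply/seteqP; split=> [y yE|_ -> n _]; last exact: access_center.
  apply/esym/mdist_positivity/eqP; rewrite eq_le mdist_ge0 andbT leNgt.
  apply/negP => /rad_small[n]; rewrite ltNge => /negP; apply.
  exact/access_closure/yE.
exists (fun n => access (rad n)).
  split=> //; split.
  - move=> n; split.
    + by exists x0, r1 => w /access_sub[/Or1].
    + exact: access_connected.
    + split=> [w /access_sub[]//|/(_ b Ob)/access_sub[_]].
      rewrite ballEmdist /= ltNge /rad => /negP; apply.
      by rewrite ler_piMr ?mdist_ge0// invf_le1// ler1n.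
    + by exists x; split=> //; exact: access_center.
  - by move=> n; apply: accessS; exact: ltW.
  (* The inner relative boundary lies within [rad n.+1] of [x], the outer one at distance at least
     [rad n]. *)
  - move=> n; apply: (@lt_le_trans _ _ (rad n - rad n.+1)%:E).
      by rewrite lte_fin subr_gt0.
    apply: le_ereal_inf_tmp => _ [[u v] [[Ou bu] [Ov bv]] <-] /=; rewrite lee_fin.
    have := access_boundary Ov bv; have := access_closure bu.1.
    by have := metric_triangle x u v; lra.
  - by rewrite imp => _ ->.
(* A component in [ball x (rad n)] has diameter at most [2 * rad n] and its base point is within
   [rad n / 4] of [z], in total less than [3 * rad n]. *)
move=> d d0; have [|n nd] := rad_small (d / 3); first by rewrite divr_gt0.
exists n => a [a' za' a'a]; set C := connected_component _ _ in a'a.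
have Cd u v : C u -> C v -> mdist u v <= rad n + rad n.
  move=> /connected_component_sub[_ +] /connected_component_sub[_ +].
  rewrite !ballEmdist /= => xu xv.
  by have := metric_triangle u x v; rewrite (metric_sym u x); lra.
have : mdist (iota a') (iota a) <= rad n + rad n.
  apply: (iota_dist_le iotaP _ _ _ a'a Cd); first exact: component_connected.
    by move=> u /connected_component_sub[].
  apply: connected_component_refl; split; first exact: set_valP.
  by rewrite ballEmdist /=; have := xz a'; have := rad0 n; lra.
have := metric_triangle z (iota a') (iota a); have := rad0 n; lra.
Qed.

End chain_at_boundary_point.

(** * The homeomorphism between singleton end space and completion *)

Section homeomorphism_onto_completion.
Context {R : realType} {X Y : completeMetricType R}.
Variables (Omega : set X) (iota : Omega -> Y).
Hypothesis iotaP : mazurkiewicz_completion iota.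
Hypothesis Omega_dom : bounded_domain Omega.
Hypothesis local_conn : forall (x : X) (r : R), 0 < r ->
  exists2 s, 0 < s & forall y, mdist x y < s ->
    exists C, [/\ connected C, C `<=` ball x r, C x & C y].
Hypothesis closed_ball_cpt : forall (x : X) (r : R), compact [set y : X | mdist x y <= r].

Let open_Omega : open Omega. Proof. by case: Omega_dom. Qed.

(** The graph of the homeomorphism; existence and uniqueness in each variable yield the map and its
    inverse by choice. *)
Definition end_limit (w : end_space Omega) (z : Y) :=
  match w with
  | inl a => iota a = z
  | inr e => singleton_end e /\ forall E, \val e E -> chain_cvg iota E z
  end.

Lemma end_limit_exists (w : end_space Omega) : singleton_end_space Omega w ->
  exists z, end_limit w z.
Proof.
case: w => [a _|e [x ex]]; first by exists (iota a).
have [E cE eE] := ends_chain e.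
have [z zE] := chain_cvg_exists iotaP closed_ball_cpt cE (ex E eE).
exists z; split; first by exists x.
move=> F /(ends_memP F eE)[_ [_ FE]]; exact: chain_cvg_divides FE zE.
Qed.

Lemma end_limit_range (e : ends Omega) z : end_limit (inr e) z -> (~` range iota) z.
Proof.
move=> [[x ex] ez]; have [E cE eE] := ends_chain e.
exact: (chain_cvg_notin_range iotaP open_Omega cE (ex E eE) (ez E eE)).
Qed.

Lemma end_limit_unique w z z' : end_limit w z -> end_limit w z' -> z = z'.
Proof.
case: w => [a <- //|e [_ ez] [_ ez']]; have [E cE eE] := ends_chain e.
exact: chain_cvg_unique cE (ez E eE) (ez' E eE).
Qed.

Lemma end_limit_inj w w' z : end_limit w z -> end_limit w' z -> w = w'.
Proof.
have irange a e : iota a = z -> end_limit (inr e) z -> False.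
  by move=> <- /end_limit_range; apply; exists a.
case: w => [a|e]; case: w' => [b|e'] //=.
- move=> az bz; congr inl; apply: val_inj; apply: mdist_positivity.
  apply/eqP; rewrite eq_le mdist_ge0 andbT; apply: le_trans (iota_expands iotaP a b) _.
  by rewrite az bz mdistxx.
- by move=> az e'z; case: (irange a e' az e'z).
- by move=> ez bz; case: (irange b e bz ez).
move=> [_ ez] [_ ez']; congr inr.
have [E cE eE] := ends_chain e; have [E' cE' eE'] := ends_chain e'.
apply: (ends_eq eE eE').
exact: (chain_cvg_equiv iotaP cE cE' (ez _ eE) (ez' _ eE')).
Qed.

Lemma end_limit_surj z : exists2 w, singleton_end_space Omega w & end_limit w z.
Proof.
have [[a _ az]|nz] := pselect (range iota z); first by exists (inl a).
have [x xz] := completion_trace iotaP z.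
have [E [cE Ex] Ez] := chain_at_boundary_point iotaP Omega_dom local_conn xz nz.
have [e eE] := end_of_chain cE.
have se : singleton_end e.
  exists x => F /(ends_memP F eE)[_ [EF FE]].
  by rewrite -Ex; apply/seteqP; split; exact: impressionS.
exists (inr e) => //; split=> // F /(ends_memP F eE)[_ [_ FE]].
exact: chain_cvg_divides FE Ez.
Qed.

(** For an end, some point of a late chain set lies both in [G] and within [d] of the limit [z'];
    the doubled bound pays for this detour. *)
Lemma end_space_ball_limit (G : set X) z (d : R) w z' :
  (forall b, G (\val b) -> mdist z (iota b) < d) ->
  end_space_ball G w -> end_limit w z' -> 0 < d -> mdist z z' < d + d.
Proof.
move=> Gd; case: w => [b /= /Gd zb <- d0|e eG [_ ez] d0]; first by lra.
have [E cE eE] := ends_chain e; have [l lG] := eG E eE.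
have [k kP] := ez E eE d d0; have [b Eb] := chain_nonempty (maxn l k) cE.
have := Gd b (lG _ (chain_le cE (leq_maxl _ _) Eb)).
have := kP b (chain_le cE (leq_maxr _ _) Eb).
by have := metric_triangle z (iota b) z'; rewrite (metric_sym (iota b)); lra.
Qed.

Lemma end_limit_continuous w z (d : R) : end_limit w z -> 0 < d ->
  exists U : set (end_space Omega), [/\ open U, U w &
    forall w' z', U w' -> end_limit w' z' -> mdist z z' < d].
Proof.
move=> wz d0; have d20 : 0 < d / 2 by rewrite divr_gt0.
suff [G [oG Gw Gd]] : exists G : set X, [/\ open G, end_space_ball G w &
    forall b, G (\val b) -> mdist z (iota b) < d / 2].
  exists (end_space_ball G); split=> // [|w' z' Gw' w'z'].
    exact: end_space_ball_open.
  by have := end_space_ball_limit Gd Gw' w'z' d20; lra.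
case: w wz => [a <-|e [_ ez]].
  have [s s0 sP] := iota_continuous iotaP open_Omega local_conn a d20.
  exists (ball (\val a) s); split; first exact: mdist_ball_open.
    exact: ballxx.
  by move=> b; rewrite ballEmdist => /sP.
have [E cE eE] := ends_chain e; have [k kP] := ez E eE _ d20.
(* By [chain_interior] this open set contains [E k.+1], so it defines a neighborhood of the end. *)
exists (interior (E k)); split; first exact: open_interior.
  move=> F /(ends_memP F eE)[_ [_ FE]]; have [l Fl] := FE k.+1; exists l.
  exact: subset_trans Fl (chain_interior cE).
by move=> b /interior_subset; exact: kP.
Qed.

(* Points or ends outside [U] with limits accumulating at [z] would contain a
   sequence consisting only of points or only of ends, and it would converge to
   [w]. *)
Lemma end_limit_open (U : set (end_space Omega)) w z : open U -> U w -> end_limit w z ->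
  exists2 d : R, 0 < d & forall w' z', end_limit w' z' -> mdist z z' < d -> U w'.
Proof.
move=> oU Uw wz; have cU := (end_space_closedP (~` U)).1 (open_closedC oU).
have [d1 d10 d1P] : exists2 d : R, 0 < d & forall a, mdist z (iota a) < d -> U (inl a).
  apply: contrapT => /forall2NP H.
  have far (n : nat) : exists a, mdist z (iota a) < n.+1%:R^-1 /\ ~ U (inl a).
    have [/negP|/existsNP[a /not_implyP[za na]]] := H n.+1%:R^-1.
      by rewrite invr_gt0 ltr0Sn.
    by exists a.
  have [u uP] := choice far.
  apply: (cU (inl \o u) w) => // [n|]; first exact: (uP n).2.
  case: w Uw wz => [b Ub bz|e Ue [_ ez]].
    exists u => //; apply/cvg_mdistP => d d0; have [N NP] := invSn_lt d0.
    exists N => n /NP; apply: lt_trans; apply: le_lt_trans (iota_expands iotaP _ _) _.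
    by rewrite bz; exact: (uP n).1.
  left; exists u => // E eE k.
  have cE : chain Omega E by have [F _ eF] := ends_chain e; case: ((ends_memP E eF).1 eE).
  have [d d0 dP] := chain_cvg_neighborhood iotaP k cE (ez E eE).
  have [N NP] := invSn_lt d0; exists N => n /NP nd; apply: dP.
  exact: lt_trans (uP n).1 nd.
have [d2 d20 d2P] : exists2 d : R, 0 < d &
    forall e z', end_limit (inr e) z' -> mdist z z' < d -> U (inr e).
  apply: contrapT => /forall2NP H.
  have far (n : nat) : exists ez : ends Omega * Y,
      [/\ end_limit (inr ez.1) ez.2, mdist z ez.2 < n.+1%:R^-1 & ~ U (inr ez.1)].
    have [/negP|/existsNP[e /existsNP[z' /not_implyP[ez /not_implyP[zz ne]]]]] := H n.+1%:R^-1.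
      by rewrite invr_gt0 ltr0Sn.
    by exists (e, z').
  have [u uP] := choice far.
  case: w Uw wz => [b Ub bz|e Ue [_ ez]].
    (* Ends cannot accumulate at a point [b] of [Omega]: the impression [y] of a singleton end with
       limit close to [iota b] is equally close to [b], so it would lie in [Omega] and not on its
       boundary. *)
    have [s s0 sO] := (open_mdistP _).1 open_Omega _ (set_valP b).
    have [N NP] := invSn_lt s0; have [uz zu _] := uP N.
    have [[y ey] uy] := uz; have [E cE eE] := ends_chain (u N).1.
    have [_ _ _ /(_ y)] := cE; rewrite (ey E eE) => /(_ erefl)[cy niy].
    apply: niy; rewrite ((interior_id _).1 open_Omega); apply: sO.
    apply: le_lt_trans (NP N (leqnn N)).
    apply/ler_addgt0Pr => d d0; have d20 : 0 < d / 2 by rewrite divr_gt0.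
    have [k kP] := uy E eE _ d20.
    have : impression E y by rewrite (ey E eE).
    move=> /(_ k I)/closure_mdistP/(_ _ d20)[a Ea ya].
    pose a' : Omega := exist _ a (mem_set (chain_sub cE Ea)).
    have := kP a' Ea; have := iota_expands iotaP b a'; rewrite bz /=.
    have := metric_triangle (\val b) a y; rewrite (metric_sym a y).
    have := metric_triangle z (u N).2 (iota a').
    by move: zu; move: (N.+1%:R^-1 : R) => q; lra.
  apply: (cU (fun n => inr (u n).1) (inr e)) => // [n|]; first by case: (uP n).
  right; exists (fun n => (u n).1) => // E eE k.
  have cE : chain Omega E by have [F _ eF] := ends_chain e; case: ((ends_memP E eF).1 eE).
  have [d d0 dP] := chain_cvg_neighborhood iotaP k cE (ez E eE).
  have d20 : 0 < d / 2 by rewrite divr_gt0.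
  have [N NP] := invSn_lt d20; exists N => n /NP nd F uF.
  have [[_ uz] zu _] := uP n; have [l lP] := uz F uF _ d20; exists l => x Fx.
  have cF : chain Omega F by have [D _ uD] := ends_chain (u n).1; case: ((ends_memP F uD).1 uF).
  pose a : Omega := exist _ x (mem_set (chain_sub cF Fx)).
  apply: (dP a); have := lP a Fx; have := metric_triangle z (u n).2 (iota a).
  by move: zu nd; move: (n.+1%:R^-1 : R) => q; lra.
exists (Num.min d1 d2); first by rewrite lt_min d10.
by case=> [a z' <-|e z' ez]; rewrite lt_min => /andP[zd1 zd2]; [exact: d1P|exact: d2P ez zd2].
Qed.

Lemma end_space_homeomorphism : exists Phi : singleton_end_space Omega -> Y,
  homeomorphism Phi /\ forall w, end_limit (\val w) (Phi w).
Proof.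
have [Phi PhiP] := choice (fun w : singleton_end_space Omega => end_limit_exists (set_valP w)).
have surj z : exists w : singleton_end_space Omega, end_limit (\val w) z.
  by have [w sw wz] := end_limit_surj z; exists (exist _ w (mem_set sw)).
have [g gP] := choice surj.
exists Phi; split=> //; split.
  move=> w V /nbhs_ballP[d /= d0 dV].
  have [U [oU Uw UP]] := end_limit_continuous (PhiP w) d0.
  exists (\val @^-1` U); split=> //=; first by exists U.
  by move=> w' Uw'; apply: dV; rewrite ballEmdist; exact: UP Uw' (PhiP w').
exists g; split.
- by move=> w; apply: val_inj; exact: end_limit_inj (gP _) (PhiP w).
- by move=> z; exact: end_limit_unique (PhiP _) (gP z).
move=> z V [_ [/= [U oU <-] /= Uz UV]].
have [d d0 dP] := end_limit_open oU Uz (gP z).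
apply/nbhs_ballP; exists d => // z'; rewrite ballEmdist /= => zz'.
by apply: UV; exact: dP (gP z') zz'.
Qed.

End homeomorphism_onto_completion.

Theorem theorem9p6 (R : realType) (p : R) (X : completeMetricType R)
    (mu : {measure set (borel X) -> \bar R}) (Omega : set X)
    (Y : completeMetricType R) (iota : Omega -> Y) :
  1 <= p ->
  (exists x y : X, x <> y) ->
  finite_positive_on_balls mu ->
  doubling mu ->
  poincare p mu ->
  Omega `<` [set: X] ->
  bounded_domain Omega ->
  mazurkiewicz_completion iota ->
  exists Phi : singleton_end_space Omega -> Y,
    [/\ homeomorphism Phi,
        forall (z : singleton_end_space Omega) (x : Omega),
          \val z = inl x -> Phi z = iota x
      & forall (z : singleton_end_space Omega) (e : ends Omega),
          \val z = inr e -> (~` range iota) (Phi z)].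
Proof.
move=> p1 _ mu_ball mu_doubling mu_poincare _ Omega_dom iotaP.
have local_conn := @locally_connected _ _ _ _ mu_ball p1 mu_poincare mu_doubling.
have closed_ball_cpt := @mdist_closed_ball_compact _ _ _ mu_ball mu_doubling.
have [Phi [Phi_homeo PhiP]] := end_space_homeomorphism iotaP Omega_dom local_conn closed_ball_cpt.
exists Phi; split=> // [w x wx|w e we].
  by have := PhiP w; rewrite wx => /=.
have := PhiP w; rewrite we; exact: (end_limit_range iotaP Omega_dom).
Qed.
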